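(* Let $g_{can}$ be the standard (round) Riemannian metric on the unit sphere $\mathbb{S}^7\subset\mathbb{R}^8$ and let $(\mathbb{S}^7,\omega,g_{can})$ be a nearly parallel $\mathrm{G}_2$-structure. Then it is conjugate, under the action of the isometry group $\mathrm{SO}(8)$, to the standard nearly parallel $\mathrm{G}_2$-structure $\omega^{std}$ of $\mathbb{S}^7$; that is, there exists $h\in\mathrm{SO}(8)$ such that $h^*\omega^{std}=\omega$.
   Context: The metric $g_{can}$ is induced by the Euclidean inner product $\langle\cdot,\cdot\rangle$ of $\mathbb{R}^8$, and $\mathrm{SO}(8)$ acts on $\mathbb{S}^7$ by restriction of its standard linear action on $\mathbb{R}^8$. Let $V$ be a $7$-dimensional Euclidean vector space. A $3$-form on $V$ is of $\mathrm{G}_2$-type compatible with the inner product if there is an orthonormal basis of $V$ with dual basis $e^1,\dots,e^7$ in which it equals $$\varphi_0=e^{123}+e^{145}+e^{167}+e^{246}-e^{257}-e^{347}-e^{356},$$ where $e^{ijk}=e^i\wedge e^j\wedge e^k$; it then determines the orientation of $V$ given by $e^1\wedge\cdots\wedge e^7$. With respect to this orientation the Hodge dual is $$*\varphi_0=e^{4567}+e^{2367}+e^{2345}+e^{1357}-e^{1346}-e^{1256}-e^{1247}.$$ A $\mathrm{G}_2$-structure $(M^7,\omega,g)$ on a Riemannian $7$-manifold $(M^7,g)$ is a smooth $3$-form $\omega$ that is, at each point, of $\mathrm{G}_2$-type compatible with $g$. It is called nearly parallel if $d\omega=\tau_0\cdot{*\omega}$ for a constant $\tau_0\neq 0$, where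 $*$ is the Hodge operator of $g$ and of the orientation determined by $\omega$. The standard nearly parallel $\mathrm{G}_2$-structure on $\mathbb{S}^7$: write $\mathbb{R}^8=\mathbb{R}e_0\oplus\mathbb{R}^7$ with dual basis $e^0,\dots,e^7$, and let $\Phi_0=e^0\wedge\varphi_0+{*\varphi_0}$ (with $\varphi_0$ and $*\varphi_0$ the forms on $\mathbb{R}^7$ displayed above). Then $\omega^{std}_x(u,v,w)=\Phi_0(x,u,v,w)$ for $x\in\mathbb{S}^7$ and $u,v,w\in T_x\mathbb{S}^7=\{u\in\mathbb{R}^8:\langle x,u\rangle=0\}$.
   Formalization: The SO(8) conjugacy is stated for τ_0>0 and ω inducing the standard orientation, since −ω^std and the pullback of ω^std by a reflection are nearly parallel but not SO(8)-conjugate to it; in general h∈O(8) with h^*ω^std=sign(τ_0)ω is given. *)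

(* Defs.v *)
From HB Require Import structures.
From mathcomp Require Import all_boot all_order all_algebra.
From mathcomp Require Import all_classical all_reals all_analysis.
Set Implicit Arguments.
Unset Strict Implicit.
Unset Printing Implicit Defensive.
Import Order.TTheory GRing.Theory Num.Theory.
Import numFieldNormedType.Exports.
Local Open Scope classical_set_scope.
Local Open Scope ring_scope.

(* R^n is 'rV[R]_n.  The value of a k-form on the vectors v_0, ..., v_(k-1) is
   written as its value on the k x n matrix A with rows v_0, ..., v_(k-1). *)

Section Forms.
Variable R : realType.

Definition form (k n : nat) := 'M[R]_(k, n) -> R.

(* A field of k-forms on (a subset of) R^n; its values outside the subset, and
   on vectors not tangent to it, are never used. *)
Definition diff_form (k n : nat) := 'rV[R]_n -> form k n.

Definition dot (n : nat) (u v : 'rV[R]_n) : R := \sum_(i < n) u 0 i * v 0 i.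

Definition enorm (n : nat) (u : 'rV[R]_n) : R := Num.sqrt (dot u u).

(* Infinite differentiability on an open set D: every iterated directional
   derivative of f is Frechet differentiable at every point of D. *)
Definition iter_derive (n : nat) (s : seq 'rV[R]_n.+1) (f : 'rV[R]_n.+1 -> R) :
    'rV[R]_n.+1 -> R :=
  foldr (fun v g => fun x => 'D_v g x) f s.

Definition smooth_on (n : nat) (D : set 'rV[R]_n.+1) (f : 'rV[R]_n.+1 -> R) :=
  forall (s : seq 'rV[R]_n.+1) (x : 'rV[R]_n.+1),
    D x -> differentiable (iter_derive s f) x.

Definition smooth_form_on (k n : nat) (D : set 'rV[R]_n.+1)
    (eta : diff_form k n.+1) :=
  forall A : 'M[R]_(k, n.+1), smooth_on D (fun x => eta x A).

Definition pullback (k m n : nat) (f : 'rV[R]_m.+1 -> 'rV[R]_n.+1)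
    (eta : diff_form k n.+1) : diff_form k m.+1 :=
  fun x A => eta (f x) (\matrix_(i < k) 'D_(row i A) f x).

(* (d eta)(v_0, ..., v_k) =
     \sum_i (-1)^i D_{v_i} (eta (v_0, ..., v_(i-1), v_(i+1), ..., v_k)). *)
Definition ext_derive (k n : nat) (eta : diff_form k n.+1) :
    diff_form k.+1 n.+1 :=
  fun x A =>
    \sum_(i < k.+1) (-1) ^+ i * 'D_(row i A) (fun y => eta y (row' i A)) x.

(* The covector monomials e^{ijk...} on R^7, with the indices 1, ..., 7. *)
Definition e_ (k : nat) (s : k.-tuple nat) : form k 7 :=
  fun A => \det (\matrix_(a < k, b < k) A a (inord (tnth s b).-1)).

Definition phi0 : form 3 7 := fun A =>
  e_ [tuple 1; 2; 3]%N A + e_ [tuple 1; 4; 5]%N A + e_ [tuple 1; 6; 7]%N A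
  + e_ [tuple 2; 4; 6]%N A - e_ [tuple 2; 5; 7]%N A
  - e_ [tuple 3; 4; 7]%N A - e_ [tuple 3; 5; 6]%N A.

Definition star_phi0 : form 4 7 := fun A =>
  e_ [tuple 4; 5; 6; 7]%N A + e_ [tuple 2; 3; 6; 7]%N A
  + e_ [tuple 2; 3; 4; 5]%N A + e_ [tuple 1; 3; 5; 7]%N A
  - e_ [tuple 1; 3; 4; 6]%N A - e_ [tuple 1; 2; 5; 6]%N A
  - e_ [tuple 1; 2; 4; 7]%N A.

(* Phi_0 = e^0 /\ phi_0 + *phi_0 on R^8 = R e_0 + R^7. *)
Definition Phi0 : form 4 8 := fun A : 'M[R]_(4, 1 + 7) =>
  \sum_(i < 4) (-1) ^+ i * A i 0 * phi0 (rsubmx (row' i A))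
  + star_phi0 (rsubmx A).

End Forms.

Section SevenSphere.
Variable R : realType.

Definition sphere7 : set 'rV[R]_8 := [set x | dot x x = 1].

(* All rows of A lie in T_x S^7. *)
Definition tangent (k : nat) (x : 'rV[R]_8) (A : 'M[R]_(k, 8)) :=
  forall i : 'I_k, dot x (row i A) = 0.

Definition eq_on_sphere (k : nat) (alpha beta : diff_form R k 8) :=
  forall (x : 'rV[R]_8) (A : 'M[R]_(k, 8)),
    sphere7 x -> tangent x A -> alpha x A = beta x A.

Definition radial (y : 'rV[R]_8) : 'rV[R]_8 := (enorm y)^-1 *: y.

(* The radial projection rho : R^8 \ {0} -> S^7 is a submersion which restricts
   to the identity on S^7.  Hence a form alpha on S^7 is smooth if and only if
   rho^* alpha is smooth on the open set R^8 \ {0}, and, with i the inclusion of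
   S^7, naturality of d gives d alpha = i^* rho^* (d alpha) = i^* d (rho^* alpha);
   so d alpha on S^7 is the restriction of d (rho^* alpha) to tangent vectors. *)
Definition sphere_smooth (k : nat) (alpha : diff_form R k 8) :=
  smooth_form_on [set y | y != 0] (pullback radial alpha).

Definition sphere_d (k : nat) (alpha : diff_form R k 8) : diff_form R k.+1 8 :=
  ext_derive (pullback radial alpha).

(* The rows of B form an orthonormal basis of T_x S^7. *)
Definition orthonormal_frame (x : 'rV[R]_8) (B : 'M[R]_(7, 8)) :=
  tangent x B /\ forall i j : 'I_7, dot (row i B) (row j B) = (i == j)%:R.

(* The coordinates, in the orthonormal frame B, of the tangent vectors which are
   the rows of A. *)
Definition coords (k : nat) (B : 'M[R]_(7, 8)) (A : 'M[R]_(k, 8)) :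
    'M[R]_(k, 7) :=
  \matrix_(a < k, i < 7) dot (row a A) (row i B).

Definition g2_frame (omega : diff_form R 3 8) (x : 'rV[R]_8)
    (B : 'M[R]_(7, 8)) :=
  orthonormal_frame x B /\
  forall A : 'M[R]_(3, 8), tangent x A -> omega x A = phi0 (coords B A).

(* A G_2-structure compatible with the round metric.  That omega x is alternating
   and trilinear on T_x S^7 is part of the existence of a G_2-frame. *)
Definition g2_structure (omega : diff_form R 3 8) :=
  sphere_smooth omega /\ forall x, sphere7 x -> exists B, g2_frame omega x B.

(* The volume form of the orientation in which the orthonormal frame B is
   positive. *)
Definition vol (B : 'M[R]_(7, 8)) : form R 7 8 := fun A => \det (coords B A).

(* The Hodge dual of a 3-form with respect to the orthonormal frame B = (b_i) and
   its orientation: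
     *alpha = \sum_(i<j<k) alpha(b_i, b_j, b_k) vol(b_i, b_j, b_k, -, -, -, -). *)
Definition hodge (B : 'M[R]_(7, 8)) (alpha : form R 3 8) : form R 4 8 := fun A =>
  \sum_(i < 7) \sum_(j < 7 | (i < j)%N) \sum_(k < 7 | (j < k)%N)
    let C : 'M[R]_(3, 8) := rowsub (tnth [tuple i; j; k]) B in
    alpha C * vol B (col_mx C A).

(* d omega = tau0 * omega on S^7.  Any two G_2-frames of omega at x differ by an
   element of G_2, which lies in SO(7), so they define the same orientation and
   the same Hodge operator. *)
Definition nearly_parallel (omega : diff_form R 3 8) (tau0 : R) :=
  [/\ g2_structure omega, tau0 != 0 &
      forall (x : 'rV[R]_8), sphere7 x ->
      exists2 B : 'M[R]_(7, 8), g2_frame omega x B &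
        forall A : 'M[R]_(4, 8), tangent x A ->
          sphere_d omega x A = tau0 * hodge B (omega x) A].

Definition omega_std : diff_form R 3 8 := fun x A => Phi0 (col_mx x A).

(* omega induces the standard orientation of S^7 (outward normal first), the one
   induced by omega_std.  This and the sign of tau0 are the two invariants of the
   SO(8)-orbits: all h^* omega_std with h in SO(8) have tau0 = 4 and induce the
   standard orientation, -omega_std has tau0 = -4 and induces the opposite one,
   and for a reflection r, r^* omega_std has tau0 = 4 and induces the opposite
   one. *)
Definition std_oriented (omega : diff_form R 3 8) :=
  forall (x : 'rV[R]_8) (B : 'M[R]_(7, 8)),
    sphere7 x -> g2_frame omega x B -> 0 < \det (col_mx x B : 'M[R]_8).

Definition in_O8 (h : 'M[R]_8) := h *m h^T = 1%:M.

Definition in_SO8 (h : 'M[R]_8) := in_O8 h /\ \det h = 1.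

(* The linear action v |-> h v on R^8, written for row vectors. *)
Definition act (h : 'M[R]_8) (v : 'rV[R]_8) : 'rV[R]_8 := v *m h^T.

End SevenSphere.

(* Main.v *)
(* Write phi for phi0 in an adapted frame and psi for its Hodge dual.  The form
   eta = rho^* omega on R^8 \ {0} is |y|^-3 phi in a frame of the complement of y,
   and d eta = tau0 |y|^-4 psi.  Differentiating the contraction identity
     \sum_k phi_abk phi_cdk = delta_ac delta_bd - delta_ad delta_bc + psi_abcd
   and using d (d eta) = 0 gives linear equations for the covariant derivative T of
   omega, whose only solution is T = (tau0 / 4) psi.  Hence the derivative of
   |y|^4 eta is totally antisymmetric.  The second derivative is then symmetric in
   its first two arguments and antisymmetric in the last four, so it vanishes:
   Phi = d (|y|^4 eta) / 4 is a constant 4-form and omega at x is Phi (x, -, -, -).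
   At x0 it is x0 /\ phi + (tau0 / 4) psi; reading off omega at another point of the
   sphere forces tau0^2 = 16, and an adapted frame at x0 carries Phi to Phi0. *)
From HB Require Import structures.
Require Import Defs.
From mathcomp Require Import all_boot all_order all_algebra.
From mathcomp Require Import all_classical all_reals all_analysis.
From mathcomp Require Import ring lra zify.
Set Implicit Arguments.
Unset Strict Implicit.
Unset Printing Implicit Defensive.
Import Order.TTheory GRing.Theory Num.Theory.
Import numFieldNormedType.Exports.
Local Open Scope classical_set_scope.
Local Open Scope ring_scope.

(** * Algebra of the associative form *)

(** The field [|y|^4 eta] is the extension of [omega] that is homogeneous of degree 1: if [omega] at
    x is [Phi (x, -, -, -)], then [|y|^4 eta] at y is [Phi (y, -, -, -)], so the claim is that this
    field is linear in y. The obstacle is that G_2-frames are given point by point, with no smooth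
    choice, so nothing can be differentiated in an adapted frame. The contraction identity avoids
    this: its trace can be taken over a fixed orthonormal basis of R^8, and its [psi] is
    [tau0^-1 d omega]. It becomes an identity between [eta], its first derivatives and the metric; a
    frame is used only after differentiation, at one point. The equations for T follow the torsion
    of a G_2-structure. Their diagonal case says that each [T i] is tangent to the 7-dimensional
    orbit of 3-forms compatible with the metric, so T is a 7 x 7 matrix, and 49 = 1 + 27 + 7 + 14.
    The equation for [d omega] controls 1 + 27 + 7, the one from [d (d eta) = 0] controls 7 + 14.
    For T = s psi the four terms of [d omega] coincide, whence tau0 = 4 s. *)

Section Polynomials.
Variable R : comPzRingType.
Implicit Types u v w z : nat -> R.

Definition det3 u v w i j k : R :=
  u i * (v j * w k - v k * w j) - u j * (v i * w k - v k * w i)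
  + u k * (v i * w j - v j * w i).

Definition det4 u v w z i j k l : R :=
  u i * det3 v w z j k l - u j * det3 v w z i k l + u k * det3 v w z i j l
  - u l * det3 v w z i j k.

Definition phi_of u v w : R :=
  det3 u v w 1 2 3 + det3 u v w 1 4 5 + det3 u v w 1 6 7 + det3 u v w 2 4 6
  - det3 u v w 2 5 7 - det3 u v w 3 4 7 - det3 u v w 3 5 6.

Definition psi_of u v w z : R :=
  det4 u v w z 4 5 6 7 + det4 u v w z 2 3 6 7 + det4 u v w z 2 3 4 5
  + det4 u v w z 1 3 5 7 - det4 u v w z 1 3 4 6 - det4 u v w z 1 2 5 6
  - det4 u v w z 1 2 4 7.

Definition basis_vec (a : nat) : nat -> R := fun l => (l == a)%:R.

Definition sum7 (F : nat -> R) : R :=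
  F 1%N + F 2%N + F 3%N + F 4%N + F 5%N + F 6%N + F 7%N.

Lemma phi_of_swap12 u v w : phi_of v u w = - phi_of u v w.
Proof. by rewrite /phi_of /det3; ring. Qed.

Lemma phi_of_swap23 u v w : phi_of u w v = - phi_of u v w.
Proof. by rewrite /phi_of /det3; ring. Qed.

Lemma phi_ofDl u u' v w : phi_of (fun l => u l + u' l) v w = phi_of u v w + phi_of u' v w.
Proof. by rewrite /phi_of /det3; ring. Qed.

Lemma phi_ofZl c u v w : phi_of (fun l => c * u l) v w = c * phi_of u v w.
Proof. by rewrite /phi_of /det3; ring. Qed.

Lemma psi_of_swap12 u v w z : psi_of v u w z = - psi_of u v w z.
Proof. by rewrite /psi_of /det4 /det3; ring. Qed.

Lemma psi_of_swap23 u v w z : psi_of u w v z = - psi_of u v w z.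
Proof. by rewrite /psi_of /det4 /det3; ring. Qed.

Lemma psi_of_swap34 u v w z : psi_of u v z w = - psi_of u v w z.
Proof. by rewrite /psi_of /det4 /det3; ring. Qed.

(** Polarization of [|u x v|^2 = |u|^2 |v|^2 - <u, v>^2] for the cross product defined by [phi_of];
    [psi_of] is the alternating part that the quadratic identity does not see. Both sides are
    polynomials in 28 coordinates. *)
Lemma phi_of_contract u v w z :
  sum7 (fun k => phi_of u v (basis_vec k) * phi_of w z (basis_vec k)) =
  sum7 (fun k => u k * w k) * sum7 (fun k => v k * z k)
  - sum7 (fun k => u k * z k) * sum7 (fun k => v k * w k) + psi_of u v w z.
Proof.
rewrite /sum7 /phi_of /psi_of /det4 /det3 /basis_vec /=.
by ring.
Qed.

End Polynomials.

(** The structure constants live in [int], where they evaluate by computation; [phi_of_basis] and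
    [psi_of_basis] carry the values to an abstract ring. *)
Definition phi_coef a b c : int := phi_of (basis_vec _ a) (basis_vec _ b) (basis_vec _ c).
Definition psi_coef a b c d : int :=
  psi_of (basis_vec _ a) (basis_vec _ b) (basis_vec _ c) (basis_vec _ d).

Lemma basis_vec_int (R : comPzRingType) a l : basis_vec R a l = (basis_vec int a l)%:~R.
Proof. by rewrite /basis_vec; case: eqP. Qed.

Lemma det3_int (R : comPzRingType) a b c i j k :
  det3 (basis_vec R a) (basis_vec R b) (basis_vec R c) i j k =
    (det3 (basis_vec _ a) (basis_vec _ b) (basis_vec _ c) i j k)%:~R.
Proof. by rewrite /det3 !(@basis_vec_int R) !(intrD, intrM, mulrNz). Qed.

Lemma det4_int (R : comPzRingType) a b c d i j k l :
  det4 (basis_vec R a) (basis_vec R b) (basis_vec R c) (basis_vec R d) i j k l =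
    (det4 (basis_vec _ a) (basis_vec _ b) (basis_vec _ c) (basis_vec _ d) i j k l)%:~R.
Proof. by rewrite /det4 !(@det3_int R) !(@basis_vec_int R) !(intrD, intrM, mulrNz). Qed.

Lemma phi_of_basis (R : comPzRingType) a b c :
  phi_of (basis_vec R a) (basis_vec R b) (basis_vec R c) = (phi_coef a b c)%:~R.
Proof.
rewrite /phi_coef /phi_of !(@det3_int R).
by do 7! move: (@det3 int _ _ _ _ _ _) => ?; rewrite !(intrD, mulrNz).
Qed.

Lemma psi_of_basis (R : comPzRingType) a b c d :
  psi_of (basis_vec R a) (basis_vec R b) (basis_vec R c) (basis_vec R d) =
    (psi_coef a b c d)%:~R.
Proof.
rewrite /psi_coef /psi_of !(@det4_int R).
by do 7! move: (@det4 int _ _ _ _ _ _ _ _) => ?; rewrite !(intrD, mulrNz).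
Qed.

Section Sparse.
Variable R : realFieldType.

Definition lin (z : nat -> int) (F : nat -> R) : R :=
  sum7 (fun k => (z k)%:~R * F k).

(** In a row of structure constants at most one entry is nonzero: two indices of a term of [phi], or
    three of a term of [psi], determine the last. Each [lin] thus collapses to plus or minus a
    single value. *)
Definition sparse (z : nat -> int) : seq (int * nat) :=
  [seq (z k, k) | k <- iota 1 7 & z k != 0].

(** [Negz 0] is -1: the coefficients that occur, 0 and plus or minus 1, disappear by reduction and
    leave no cast for [lra]. *)
Definition sterm (s : int) (x : R) : R :=
  match s with Posz 0 => 0 | Posz 1 => x | Negz 0 => - x | _ => s%:~R * x end.

Fixpoint lsum (F : nat -> R) (l : seq (int * nat)) : R :=
  match l with
  | [::] => 0
  | [:: p] => sterm p.1 (F p.2)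
  | p :: l' => sterm p.1 (F p.2) + lsum F l'
  end.

Lemma stermE s x : sterm s x = s%:~R * x.
Proof.
by case: s => [[|[|n]]|[|n]] //=; rewrite ?mul0r ?mul1r ?mulN1r.
Qed.

Lemma lin_sparse z F : lin z F = lsum F (sparse z).
Proof.
have lsumE l : lsum F l = \sum_(p <- l) p.1%:~R * F p.2.
  elim: l => [|p [|q l] IH] /=; first by rewrite big_nil.
    by rewrite big_seq1 stermE.
  by rewrite big_cons -IH stermE.
rewrite lsumE /sparse big_map big_filter big_mkcond.
have h k : (if z k != 0 then (z k)%:~R * F k else 0) = (z k)%:~R * F k.
  by case: eqP => // ->; rewrite mul0r.
by rewrite /lin /sum7 [iota 1 7]/= !big_cons big_nil /= !h addr0 !addrA.
Qed.

End Sparse.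

Ltac eval_sparse :=
  repeat match goal with
  | |- context [sparse ?z] =>
    let v := eval vm_compute in (sparse z) in change (sparse z) with v
  | |- context [intmul 1 (psi_coef ?a ?b ?c ?d) * ?t] =>
    let v := eval vm_compute in (psi_coef a b c d) in
    change (psi_coef a b c d) with v; rewrite -[v%:~R * t]stermE
  end;
  cbv [lsum sterm fst snd].

(** * The torsion at a point, as linear algebra *)

Section Torsion.
Variable R : realFieldType.
Ltac eval_lin := rewrite ?lin_sparse; eval_sparse.

Ltac sort3 chi c12 c23 :=
  repeat match goal with
  | |- context [chi ?a ?b ?c] =>
      let t := eval vm_compute in (b < a)%N in
      match t with true => rewrite (c12 b a c) end
  | |- context [chi ?a ?b ?c] =>
      let t := eval vm_compute in (c < b)%N in
      match t with true => rewrite (c23 a c b) end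
  end.

Lemma alt3_eq (f g : nat -> nat -> nat -> R) :
  (forall a b c, f b a c = - f a b c) -> (forall a b c, f a c b = - f a b c) ->
  (forall a b c, g b a c = - g a b c) -> (forall a b c, g a c b = - g a b c) ->
  (forall a b c, (0 < a)%N -> (a < b)%N -> (b < c)%N -> (c < 8)%N -> f a b c = g a b c) ->
  forall a b c, (0 < a < 8)%N -> (0 < b < 8)%N -> (0 < c < 8)%N -> f a b c = g a b c.
Proof.
move=> f12 f23 g12 g23 H.
have f0 a c : f a a c = 0 by have := f12 a a c; lra.
have f0' a c : f a c c = 0 by have := f23 a c c; lra.
have f0'' a c : f a c a = 0 by rewrite f23 f0 oppr0.
have g0 a c : g a a c = 0 by have := g12 a a c; lra.
have g0' a c : g a c c = 0 by have := g23 a c c; lra.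
have g0'' a c : g a c a = 0 by rewrite g23 g0 oppr0.
move=> a b c /andP[a0 a8] /andP[b0 b8] /andP[c0 c8].
case: (ltngtP a b) => [ab|ba|->]; last by rewrite f0 g0.
- case: (ltngtP b c) => [bc|cb|->]; [exact: H| |by rewrite f0' g0'].
  case: (ltngtP a c) => [ac|ca|->]; last by rewrite f0'' g0''.
  + by rewrite f23 g23 H.
  + by rewrite f23 g23 f12 g12 H.
- case: (ltngtP a c) => [ac|ca|->]; last by rewrite f0'' g0''.
  + by rewrite f12 g12 H.
  + case: (ltngtP b c) => [bc|cb|->]; last by rewrite f0' g0'.
    * by rewrite f12 g12 f23 g23 H.
    * by rewrite f12 g12 f23 g23 f12 g12 H.
Qed.

(* Every instance of the last hypothesis relates one value of [chi] to plus or
   minus another one.  Each [S m] is the value of [chi] at a triple on which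
   [psi_coef m] does not vanish. *)
Lemma phi_variation (chi : nat -> nat -> nat -> R) :
  (forall a b c, chi b a c = - chi a b c) ->
  (forall a b c, chi a c b = - chi a b c) ->
  (forall a b c, (0 < a < 8)%N -> (0 < b < 8)%N -> (0 < c < 8)%N ->
     lin (phi_coef a b) (chi c b) + lin (phi_coef c b) (chi a b) = 0) ->
  {S : nat -> R | forall a b c, (0 < a < 8)%N -> (0 < b < 8)%N -> (0 < c < 8)%N ->
    chi a b c = lin (fun m => psi_coef m a b c) S}.
Proof.
move=> c12 c23 E.
exists (fun m => nth 0 [:: 0; - chi 2%N 4%N 7%N; chi 1%N 4%N 7%N; chi 1%N 4%N 6%N;
  - chi 1%N 2%N 7%N; - chi 1%N 2%N 6%N; chi 1%N 2%N 5%N; chi 1%N 2%N 4%N] m).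
apply: alt3_eq => //.
- by move=> a b c; rewrite /lin /sum7 -!psi_of_basis !(psi_of_swap23 _ (basis_vec _ a));
    ring.
- by move=> a b c; rewrite /lin /sum7 -!psi_of_basis !(psi_of_swap34 _ _ (basis_vec _ b));
    ring.
(* An alternating [chi] has 35 free values and the answer leaves 7 of them; these are 28 independent
   equations. *)
have := E 1%N 2%N 1%N isT isT isT; eval_lin; sort3 chi c12 c23 => ?.
have := E 2%N 1%N 4%N isT isT isT; eval_lin; sort3 chi c12 c23 => ?.
have := E 2%N 1%N 5%N isT isT isT; eval_lin; sort3 chi c12 c23 => ?.
have := E 2%N 1%N 6%N isT isT isT; eval_lin; sort3 chi c12 c23 => ?.
have := E 2%N 1%N 7%N isT isT isT; eval_lin; sort3 chi c12 c23 => ?.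
have := E 1%N 4%N 1%N isT isT isT; eval_lin; sort3 chi c12 c23 => ?.
have := E 4%N 1%N 6%N isT isT isT; eval_lin; sort3 chi c12 c23 => ?.
have := E 4%N 1%N 7%N isT isT isT; eval_lin; sort3 chi c12 c23 => ?.
have := E 1%N 6%N 1%N isT isT isT; eval_lin; sort3 chi c12 c23 => ?.
have := E 1%N 2%N 4%N isT isT isT; eval_lin; sort3 chi c12 c23 => ?.
have := E 1%N 2%N 5%N isT isT isT; eval_lin; sort3 chi c12 c23 => ?.
have := E 1%N 2%N 6%N isT isT isT; eval_lin; sort3 chi c12 c23 => ?.
have := E 1%N 2%N 7%N isT isT isT; eval_lin; sort3 chi c12 c23 => ?.
have := E 1%N 4%N 2%N isT isT isT; eval_lin; sort3 chi c12 c23 => ?.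
have := E 2%N 4%N 2%N isT isT isT; eval_lin; sort3 chi c12 c23 => ?.
have := E 4%N 2%N 5%N isT isT isT; eval_lin; sort3 chi c12 c23 => ?.
have := E 2%N 5%N 2%N isT isT isT; eval_lin; sort3 chi c12 c23 => ?.
have := E 1%N 6%N 2%N isT isT isT; eval_lin; sort3 chi c12 c23 => ?.
have := E 1%N 4%N 3%N isT isT isT; eval_lin; sort3 chi c12 c23 => ?.
have := E 2%N 4%N 3%N isT isT isT; eval_lin; sort3 chi c12 c23 => ?.
have := E 3%N 4%N 3%N isT isT isT; eval_lin; sort3 chi c12 c23 => ?.
have := E 3%N 5%N 3%N isT isT isT; eval_lin; sort3 chi c12 c23 => ?.
have := E 2%N 7%N 3%N isT isT isT; eval_lin; sort3 chi c12 c23 => ?.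
have := E 1%N 7%N 3%N isT isT isT; eval_lin; sort3 chi c12 c23 => ?.
have := E 1%N 4%N 6%N isT isT isT; eval_lin; sort3 chi c12 c23 => ?.
have := E 1%N 5%N 7%N isT isT isT; eval_lin; sort3 chi c12 c23 => ?.
have := E 1%N 6%N 4%N isT isT isT; eval_lin; sort3 chi c12 c23 => ?.
have := E 1%N 7%N 5%N isT isT isT; eval_lin; sort3 chi c12 c23 => ?.
do 3 (case=> [|[|[|[|[|[|[|[|?]]]]]]]] //); move=> _ _ _ _; eval_lin; rewrite /=.
all: lra.
Qed.

Ltac instance S_of eqn :=
  have := eqn; eval_lin; rewrite !S_of //; eval_lin; move=> ?.

(* [T] stands for the covariant derivative of [omega] at a point, in an adapted
   frame.  The third hypothesis is a diagonal case of the derived contraction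
   identity, the fourth is the nearly parallel equation, and the last one is
   [d (d omega) = 0] rewritten with the contraction identity. *)
Lemma torsion_scalar (T : nat -> nat -> nat -> nat -> R) (tau : R) :
  (forall i a b c, T i b a c = - T i a b c) ->
  (forall i a b c, T i a c b = - T i a b c) ->
  (forall i a b c, (0 < i < 8)%N -> (0 < a < 8)%N -> (0 < b < 8)%N -> (0 < c < 8)%N ->
     lin (phi_coef a b) (T i c b) + lin (phi_coef c b) (T i a b) = 0) ->
  (forall a b c d, (0 < a < 8)%N -> (0 < b < 8)%N -> (0 < c < 8)%N -> (0 < d < 8)%N ->
     T a b c d - T b a c d + T c a b d - T d a b c = (psi_coef a b c d)%:~R * tau) ->
  (let Q i a b c d :=
     lin (phi_coef c d) (T i a b) + lin (phi_coef a b) (T i c d) in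
   forall i a b c d, (0 < i < 8)%N ->
     (0 < a < 8)%N -> (0 < b < 8)%N -> (0 < c < 8)%N -> (0 < d < 8)%N ->
     Q i a b c d - Q a i b c d + Q b i a c d - Q c i a b d + Q d i a b c = 0) ->
  forall i a b c, (0 < i < 8)%N -> (0 < a < 8)%N -> (0 < b < 8)%N -> (0 < c < 8)%N ->
    T i a b c = (psi_coef i a b c)%:~R * (tau / 4%:R).
Proof.
move=> T12 T23 E1 E2 E3.
have /all_sig [S hS] : forall i, {S : nat -> R | (0 < i < 8)%N ->
    forall a b c, (0 < a < 8)%N -> (0 < b < 8)%N -> (0 < c < 8)%N ->
    T i a b c = lin (fun m => psi_coef m a b c) S}.
  move=> i; case i18: (0 < i < 8)%N; last by exists (fun=> 0).
  by have [S hS] := phi_variation (T12 i) (T23 i) (fun a b c => E1 i a b c i18); exists S.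
(* In binary, the terms of [phi] and of [psi] are index sets with XOR 0. Hence each equation
   involves only entries [S i j] with one value of i XOR j, and the system decouples: the blocks
   below are the values 1, ..., 7 and then the diagonal. *)
have off :
  (S 2%N 3%N = 0 /\ S 3%N 2%N = 0 /\ S 4%N 5%N = 0 /\
   S 5%N 4%N = 0 /\ S 6%N 7%N = 0 /\ S 7%N 6%N = 0) /\
  (S 1%N 3%N = 0 /\ S 3%N 1%N = 0 /\ S 4%N 6%N = 0 /\
   S 6%N 4%N = 0 /\ S 5%N 7%N = 0 /\ S 7%N 5%N = 0) /\
  (S 1%N 2%N = 0 /\ S 2%N 1%N = 0 /\ S 4%N 7%N = 0 /\
   S 7%N 4%N = 0 /\ S 5%N 6%N = 0 /\ S 6%N 5%N = 0) /\
  (S 1%N 5%N = 0 /\ S 5%N 1%N = 0 /\ S 2%N 6%N = 0 /\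
   S 6%N 2%N = 0 /\ S 3%N 7%N = 0 /\ S 7%N 3%N = 0) /\
  (S 1%N 4%N = 0 /\ S 4%N 1%N = 0 /\ S 2%N 7%N = 0 /\
   S 7%N 2%N = 0 /\ S 3%N 6%N = 0 /\ S 6%N 3%N = 0) /\
  (S 1%N 7%N = 0 /\ S 7%N 1%N = 0 /\ S 2%N 4%N = 0 /\
   S 4%N 2%N = 0 /\ S 3%N 5%N = 0 /\ S 5%N 3%N = 0) /\
  (S 1%N 6%N = 0 /\ S 6%N 1%N = 0 /\ S 2%N 5%N = 0 /\
   S 5%N 2%N = 0 /\ S 3%N 4%N = 0 /\ S 4%N 3%N = 0) /\
  (S 1%N 1%N = tau / 4%:R /\ S 2%N 2%N = tau / 4%:R /\ S 3%N 3%N = tau / 4%:R /\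
   S 4%N 4%N = tau / 4%:R /\ S 5%N 5%N = tau / 4%:R /\ S 6%N 6%N = tau / 4%:R /\
   S 7%N 7%N = tau / 4%:R).
  split.
    (* In each off-diagonal block, [E3] at the complements of the three pairs makes [S] symmetric,
       and [E2] then kills the symmetric part. *)
    have [? ? ?] :
        [/\ S 2%N 3%N = S 3%N 2%N, S 4%N 5%N = S 5%N 4%N & S 6%N 7%N = S 7%N 6%N].
      instance hS (E3 1%N 2%N 3%N 4%N 5%N isT isT isT isT isT).
      instance hS (E3 1%N 2%N 3%N 6%N 7%N isT isT isT isT isT).
      instance hS (E3 1%N 4%N 5%N 6%N 7%N isT isT isT isT isT).
      by split; lra.
    instance hS (E2 1%N 2%N 4%N 6%N isT isT isT isT).
    instance hS (E2 1%N 2%N 5%N 7%N isT isT isT isT).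
    instance hS (E2 1%N 3%N 4%N 7%N isT isT isT isT).
    by repeat split; lra.
  split.
    have [? ? ?] :
        [/\ S 1%N 3%N = S 3%N 1%N, S 4%N 6%N = S 6%N 4%N & S 5%N 7%N = S 7%N 5%N].
      instance hS (E3 1%N 2%N 3%N 4%N 6%N isT isT isT isT isT).
      instance hS (E3 1%N 2%N 3%N 5%N 7%N isT isT isT isT isT).
      instance hS (E3 2%N 4%N 5%N 6%N 7%N isT isT isT isT isT).
      by split; lra.
    instance hS (E2 1%N 2%N 4%N 5%N isT isT isT isT).
    instance hS (E2 1%N 2%N 6%N 7%N isT isT isT isT).
    instance hS (E2 2%N 3%N 4%N 7%N isT isT isT isT).
    by repeat split; lra.
  split.
    have [? ? ?] :
        [/\ S 1%N 2%N = S 2%N 1%N, S 4%N 7%N = S 7%N 4%N & S 5%N 6%N = S 6%N 5%N].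
      instance hS (E3 1%N 2%N 3%N 4%N 7%N isT isT isT isT isT).
      instance hS (E3 1%N 2%N 3%N 5%N 6%N isT isT isT isT isT).
      instance hS (E3 3%N 4%N 5%N 6%N 7%N isT isT isT isT isT).
      by split; lra.
    instance hS (E2 1%N 3%N 4%N 5%N isT isT isT isT).
    instance hS (E2 1%N 3%N 6%N 7%N isT isT isT isT).
    instance hS (E2 2%N 3%N 4%N 6%N isT isT isT isT).
    by repeat split; lra.
  split.
    have [? ? ?] :
        [/\ S 1%N 5%N = S 5%N 1%N, S 2%N 6%N = S 6%N 2%N & S 3%N 7%N = S 7%N 3%N].
      instance hS (E3 1%N 2%N 4%N 5%N 6%N isT isT isT isT isT).
      instance hS (E3 1%N 3%N 4%N 5%N 7%N isT isT isT isT isT).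
      instance hS (E3 2%N 3%N 4%N 6%N 7%N isT isT isT isT isT).
      by split; lra.
    instance hS (E2 1%N 2%N 3%N 4%N isT isT isT isT).
    instance hS (E2 1%N 4%N 6%N 7%N isT isT isT isT).
    instance hS (E2 2%N 4%N 5%N 7%N isT isT isT isT).
    by repeat split; lra.
  split.
    have [? ? ?] :
        [/\ S 1%N 4%N = S 4%N 1%N, S 2%N 7%N = S 7%N 2%N & S 3%N 6%N = S 6%N 3%N].
      instance hS (E3 1%N 2%N 4%N 5%N 7%N isT isT isT isT isT).
      instance hS (E3 1%N 3%N 4%N 5%N 6%N isT isT isT isT isT).
      instance hS (E3 2%N 3%N 5%N 6%N 7%N isT isT isT isT isT).
      by split; lra.
    instance hS (E2 1%N 2%N 3%N 5%N isT isT isT isT).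
    instance hS (E2 1%N 5%N 6%N 7%N isT isT isT isT).
    instance hS (E2 2%N 4%N 5%N 6%N isT isT isT isT).
    by repeat split; lra.
  split.
    have [? ? ?] :
        [/\ S 1%N 7%N = S 7%N 1%N, S 2%N 4%N = S 4%N 2%N & S 3%N 5%N = S 5%N 3%N].
      instance hS (E3 1%N 2%N 4%N 6%N 7%N isT isT isT isT isT).
      instance hS (E3 1%N 3%N 5%N 6%N 7%N isT isT isT isT isT).
      instance hS (E3 2%N 3%N 4%N 5%N 6%N isT isT isT isT isT).
      by split; lra.
    instance hS (E2 1%N 2%N 3%N 6%N isT isT isT isT).
    instance hS (E2 1%N 4%N 5%N 6%N isT isT isT isT).
    instance hS (E2 2%N 5%N 6%N 7%N isT isT isT isT).
    by repeat split; lra.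
  split.
    have [? ? ?] :
        [/\ S 1%N 6%N = S 6%N 1%N, S 2%N 5%N = S 5%N 2%N & S 3%N 4%N = S 4%N 3%N].
      instance hS (E3 1%N 2%N 5%N 6%N 7%N isT isT isT isT isT).
      instance hS (E3 1%N 3%N 4%N 6%N 7%N isT isT isT isT isT).
      instance hS (E3 2%N 3%N 4%N 5%N 7%N isT isT isT isT isT).
      by split; lra.
    instance hS (E2 1%N 2%N 3%N 7%N isT isT isT isT).
    instance hS (E2 1%N 4%N 5%N 7%N isT isT isT isT).
    instance hS (E2 2%N 4%N 6%N 7%N isT isT isT isT).
    by repeat split; lra.
    (* At a term abcd of [psi] the equation reads [S a a + S b b + S c c + S d d = tau]. The seven
       terms determine the diagonal, and this is where [tau / 4] comes from. *)
    instance hS (E2 1%N 2%N 4%N 7%N isT isT isT isT).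
    instance hS (E2 1%N 2%N 5%N 6%N isT isT isT isT).
    instance hS (E2 1%N 3%N 4%N 6%N isT isT isT isT).
    instance hS (E2 1%N 3%N 5%N 7%N isT isT isT isT).
    instance hS (E2 2%N 3%N 4%N 5%N isT isT isT isT).
    instance hS (E2 2%N 3%N 6%N 7%N isT isT isT isT).
    instance hS (E2 4%N 5%N 6%N 7%N isT isT isT isT).
    by repeat split; lra.
have SE i m : (0 < i < 8)%N -> (0 < m < 8)%N -> S i m = (i == m)%:R * (tau / 4%:R).
  move=> hi hm; clear hS T12 T23 E1 E2 E3.
  move: i m hi hm off => [|[|[|[|[|[|[|[|i]]]]]]]] + hi; try discriminate hi;
    case=> [|[|[|[|[|[|[|[|m]]]]]]]] hm; try discriminate hm; move=> off {hi hm};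
    rewrite /= ?mul0r ?mul1r;
    repeat match goal with H : _ /\ _ |- _ => destruct H end; assumption.
move=> i a b c hi ha hb hc; rewrite hS // /lin /sum7 !SE //;
  move: i hi {ha hb hc SE off hS E1 E2 E3}.
by case=> [|[|[|[|[|[|[|[|?]]]]]]]] // _; rewrite /= ?(mul0r, mul1r, mulr0, addr0, add0r).
Qed.

End Torsion.

(** * Directional derivatives *)

Section Calculus.
Context {R : realType} {V : normedModType R}.
Implicit Types (f g : V -> R) (x u v w : V).

Lemma line_quotient f x w (t : R) :
  (fun h : R => h^-1 *: (((fun s => f (x + s *: w)) \o shift t) (h *: 1) - f (x + t *: w)))
    =
  (fun h : R => h^-1 *: ((f \o shift (x + t *: w)) (h *: w) - f (x + t *: w))).
Proof.
by apply/funext => h /=; rewrite [h *: 1]mulr1 scalerDl addrCA.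
Qed.

Lemma is_derive_line f x w (t df : R) : is_derive (x + t *: w) w f df ->
  is_derive t 1 (fun s => f (x + s *: w)) df.
Proof.
move=> [fd <-]; apply: DeriveDef; first by rewrite /derivable line_quotient.
by rewrite /derive line_quotient.
Qed.

Lemma differentiable_is_derive f x v : differentiable f x -> is_derive x v f ('D_v f x).
Proof. by move=> /(@diff_derivable _ _ _ _ _ v) /derivableP. Qed.

Lemma mvt_line f (df : R -> R) x w (s : R) : 0 < s ->
  (forall t, 0 <= t <= s -> is_derive (x + t *: w) w f (df t)) ->
  exists2 c, 0 < c < s & f (x + s *: w) - f x = df c * s.
Proof.
move=> s0 fd.
have [||c] := @MVT R (fun t => f (x + t *: w)) df 0 s s0.
- move=> t; rewrite in_itv /= => /andP[t0 ts].
  by apply: is_derive_line; apply: fd; rewrite !ltW.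
- apply: derivable_within_continuous => t; rewrite in_itv /= => ts.
  by have [] := is_derive_line (fd t ts).
by rewrite in_itv /= scale0r addr0 subr0 => cs ->; exists c.
Qed.

(** The mean value theorem twice: along [u] for the increment of [f] in the direction [v], then
    along [v] for ['D_u f]. *)
Lemma second_difference f x u v (s : R) : 0 < s ->
  (forall a b, 0 <= a <= s -> 0 <= b <= s ->
    differentiable f (x + a *: u + b *: v) /\
    differentiable ('D_u f) (x + a *: u + b *: v)) ->
  exists a b, [/\ 0 < a < s, 0 < b < s &
    f (x + s *: u + s *: v) - f (x + s *: u) - (f (x + s *: v) - f x)
    = 'D_v ('D_u f) (x + a *: u + b *: v) * s * s].
Proof.
move=> s0 fd.
have s0' := ltW s0.
have ss : 0 <= s <= s by apply/andP; split.
have zs : 0 <= (0 : R) <= s by apply/andP; split.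
pose F (t : R) := f (x + s *: v + t *: u) - f (x + t *: u).
pose dF (t : R) := 'D_u f (x + s *: v + t *: u) - 'D_u f (x + t *: u).
have Fd t : 0 <= t <= s -> is_derive t 1 F (dF t).
  move=> ts; apply: is_deriveB.
  - by apply: is_derive_line; apply: differentiable_is_derive; rewrite addrAC;
      have [] := fd t s ts ss.
  - by apply: is_derive_line; apply: differentiable_is_derive;
      have [] := fd t 0 ts zs; rewrite scale0r addr0.
have [||a] := @MVT R F dF 0 s s0.
- by move=> t; rewrite in_itv /= => /andP[t0 ts]; apply: Fd; rewrite !ltW.
- apply: derivable_within_continuous => t; rewrite in_itv /= => ts.
  by have [] := Fd t ts.
rewrite in_itv /= subr0 => as_ Fa.
have as' : 0 <= a <= s by case/andP: as_ => ? ?; rewrite !ltW.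
have [|b bs Fb] := @mvt_line ('D_u f) (fun t => 'D_v ('D_u f) (x + a *: u + t *: v))
  (x + a *: u) v s s0.
  by move=> t ts; apply: differentiable_is_derive; have [] := fd a t as' ts.
exists a, b; split=> //.
rewrite -Fb [x + a *: u + s *: v]addrAC -/(dF a) -Fa /F scale0r !addr0.
by rewrite [x + s *: v + s *: u]addrAC; ring.
Qed.

End Calculus.

Section Smooth.
Context {R : realType} {n : nat}.
Implicit Types (f : 'rV[R]_n.+1 -> R) (x u v : 'rV[R]_n.+1) (D : set 'rV[R]_n.+1).

(** The second difference over a small parallelogram is symmetric in [u] and [v], so the two mixed
    derivatives agree at two points near [x], and both are continuous at [x]. *)
Lemma schwarz D f x u v : open D -> D x -> smooth_on D f ->
  'D_u ('D_v f) x = 'D_v ('D_u f) x.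
Proof.
move=> oD Dx fs.
have cont w1 w2 : {for x, continuous ('D_w1 ('D_w2 f))}.
  by apply: differentiable_continuous; exact: (fs [:: w1; w2]).
apply/eqP; rewrite -subr_eq0 -normr_le0; apply/ler_addgt0Pl => e e0; rewrite addr0.
have e20 : 0 < e / 2 by rewrite divr_gt0.
have near_dist (g : 'rV[R]_n.+1 -> R) (r : R) : {for x, continuous g} -> 0 < r ->
    nbhs x [set y | `|g x - g y| < r].
  by move=> gx r0; move/cvgrPdist_lt: gx; apply.
have H : nbhs x (D `&` ([set y | `|'D_u ('D_v f) x - 'D_u ('D_v f) y| < e / 2] `&`
   [set y | `|'D_v ('D_u f) x - 'D_v ('D_u f) y| < e / 2])).
  exact: filterI (open_nbhs_nbhs (conj oD Dx))
  (filterI (near_dist _ _ (cont u v) e20) (near_dist _ _ (cont v u) e20)).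
move: H => /nbhs_ballP[d /= d0 dP].
(* The summand 1 keeps [M] positive when both directions vanish; [s * M = d / 2] keeps the
   parallelogram inside the ball. *)
pose M := `|u| + `|v| + 1.
have M0 : 0 < M by rewrite ltr_wpDl // addr_ge0.
pose s := d / 2 / M.
have s0 : 0 < s by rewrite !divr_gt0.
have inD a b : 0 <= a <= s -> 0 <= b <= s ->
    [/\ D (x + a *: u + b *: v),
      `|'D_u ('D_v f) x - 'D_u ('D_v f) (x + a *: u + b *: v)| < e / 2
      & `|'D_v ('D_u f) x - 'D_v ('D_u f) (x + a *: u + b *: v)| < e / 2].
  move=> /andP[a0 as_] /andP[b0 bs].
  suff xab : ball x d (x + a *: u + b *: v).
    by have [H1 [H2 H3]] := dP _ xab; split; [exact: H1|exact: H2|exact: H3].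
  rewrite -ball_normE /ball_ /= -addrA opprD addNKr normrN.
  apply: (le_lt_trans (ler_normD _ _)); rewrite !normrZ (ger0_norm a0) (ger0_norm b0).
  apply: (@le_lt_trans _ _ (s * M)); last first.
    by rewrite /s divfK ?gt_eqF // ltr_pdivrMr // mulr_natr mulr2n ltrDl.
  have hu : a * `|u| <= s * `|u| by apply: ler_wpM2r.
  have hv : b * `|v| <= s * `|v| by apply: ler_wpM2r.
  by rewrite /M; move: hu hv s0; move: `|u| `|v| => U W; clear; lra.
have [|a [b [as_ bs E1]]] := @second_difference R _ f x u v s s0.
  move=> a b as_ bs; have [Dab _ _] := inD a b as_ bs.
  by split; [exact: (fs [::])|exact: (fs [:: u])].
have [|a' [b' [as' bs' E2]]] := @second_difference R _ f x v u s s0.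
  move=> a' b' as' bs'; have := inD b' a' bs' as'; rewrite addrAC => -[Dab _ _].
  by split; [exact: (fs [::])|exact: (fs [:: v])].
have E : 'D_v ('D_u f) (x + a *: u + b *: v) = 'D_u ('D_v f) (x + b' *: u + a' *: v).
  have ssn0 : s * s != 0 by rewrite mulf_neq0 ?gt_eqF.
  rewrite [x + b' *: u + a' *: v]addrAC.
  move: E1 E2; rewrite [x + s *: v + s *: u]addrAC.
  move: ('D_v ('D_u f) _) ('D_u ('D_v f) _) (f _) (f _) (f _) (f _) =>
    p q f1 f2 f3 f4 E1 E2.
  apply: (mulIf ssn0); apply: (etrans (mulrA _ _ _)); apply: (etrans (esym E1)).
  by apply: (etrans _ (esym (mulrA _ _ _))); apply: (etrans _ E2); ring.
have W t : 0 < t < s -> 0 <= t <= s by case/andP=> ? ?; rewrite !ltW.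
have [_ _ H1] := inD a b (W _ as_) (W _ bs).
have [_ H2 _] := inD b' a' (W _ bs') (W _ as').
move: H1 H2; rewrite E.
move: ('D_u ('D_v f) x) ('D_v ('D_u f) x) ('D_u ('D_v f) _) => p q r H1 H2.
rewrite (_ : p - q = (p - r) - (q - r)); last by ring.
apply: (le_trans (ler_normB _ _)); rewrite (splitr e).
by apply: lerD; apply: ltW.
Qed.

End Smooth.

Section Rules.
Context {R : realType} {V : normedModType R}.
Implicit Types (f g : V -> R) (x u v w : V) (c df dg : R).

Lemma is_derive_ext f g x v df : f =1 g -> is_derive x v f df -> is_derive x v g df.
Proof. by move=> /funext ->. Qed.

Lemma is_derive_add f g x v df dg : is_derive x v f df -> is_derive x v g dg ->
  is_derive x v (fun y => f y + g y) (df + dg).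
Proof. exact: is_deriveD. Qed.

Lemma is_derive_sub f g x v df dg : is_derive x v f df -> is_derive x v g dg ->
  is_derive x v (fun y => f y - g y) (df - dg).
Proof. exact: is_deriveB. Qed.

Lemma is_derive_mul f g x v df dg : is_derive x v f df -> is_derive x v g dg ->
  is_derive x v (fun y => f y * g y) (df * g x + f x * dg).
Proof.
move=> hf hg; have H := is_deriveM hf hg.
by rewrite addrC [df * _]mulrC; exact: H.
Qed.

Lemma is_derive_const c x v : is_derive x v (fun=> c) 0.
Proof. exact: is_derive_cst. Qed.

Lemma is_derive_cmul c f x v df : is_derive x v f df ->
  is_derive x v (fun y => c * f y) (c * df).
Proof.
by move=> hf; have := is_derive_mul (is_derive_const c x v) hf; rewrite mul0r add0r.
Qed.

Lemma is_derive_bigsum n (F : 'I_n -> V -> R) (dF : 'I_n -> R) x v :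
  (forall i, is_derive x v (F i) (dF i)) ->
  is_derive x v (fun y => \sum_i F i y) (\sum_i dF i).
Proof.
move=> hF; have H := is_derive_sum hF.
by apply: is_derive_ext H => y; rewrite fct_sumE.
Qed.

Lemma is_derive_lineP f x v df :
  is_derive (0 : R) 1 (fun s => f (x + s *: v)) df <-> is_derive x v f df.
Proof.
have q := line_quotient f x v 0; rewrite scale0r addr0 in q.
split=> -[H1 H2].
- move: H1 H2; rewrite /derivable /derive /= scale0r addr0 => H1 H2.
  by apply: DeriveDef; rewrite /derivable /derive -q.
- by apply: DeriveDef; rewrite /derivable /derive /= scale0r addr0 q.
Qed.

Lemma open_nonzero : open [set y : V | y != 0].
Proof.
rewrite (_ : [set y | _] = (fun y : V => `|y|) @^-1` [set r : R | r != 0]); last first.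
  by apply/seteqP; split=> y /=; rewrite normr_eq0.
by apply: open_comp => [y _|]; [exact: norm_continuous|exact: open_neq].
Qed.

Lemma derive_near f g x v : x != 0 -> (forall y, y != 0 -> f y = g y) ->
  'D_v f x = 'D_v g x.
Proof.
move=> x0 fg; apply: near_eq_derive.
near=> y; apply: fg; near: y.
by apply: open_nbhs_nbhs; split=> //; exact: open_nonzero.
Unshelve. all: by end_near. Qed.

Lemma is_derive_near f g x v df : x != 0 -> (forall y, y != 0 -> f y = g y) ->
  is_derive x v f df -> is_derive x v g df.
Proof.
move=> x0 fg; apply: near_eq_is_derive.
near=> y; apply: fg; near: y.
by apply: open_nbhs_nbhs; split=> //; exact: open_nonzero.
Unshelve. all: by end_near. Qed.

Lemma deriveZdir f x v c : differentiable f x -> 'D_(c *: v) f x = c * 'D_v f x.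
Proof. by move=> fd; rewrite !deriveE // linearZ. Qed.

Lemma deriveDdir f x u v : differentiable f x -> 'D_(u + v) f x = 'D_u f x + 'D_v f x.
Proof. by move=> fd; rewrite !deriveE // linearD. Qed.

(** Chain rule for the dilation by [t]: the direction is scaled as well, which costs the factor
    [t^-1]. It turns degree -3 for [eta] into degree -4 for its derivative. *)
Lemma derive_dilation f x v (t c : R) : t != 0 -> x != 0 ->
  differentiable f (t *: x) -> differentiable f x ->
  (forall y, y != 0 -> f (t *: y) = c * f y) ->
  'D_v f (t *: x) = t^-1 * c * 'D_v f x.
Proof.
move=> t0 x0 fdt fd fh.
have : 'D_(t *: v) f (t *: x) = c * 'D_v f x.
  have -> : 'D_(t *: v) f (t *: x) = 'D_v (fun y => f (t *: y)) x.
    rewrite /derive (_ : (fun h : R => _) =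
      (fun h : R => h^-1 *: (((fun y => f (t *: y)) \o shift x) (h *: v) - f (t *: x)))) //.
    apply/funext => h /=.
    by rewrite [t *: (_ + _)]scalerDr [t *: (_ *: _)]scalerA [h *: (_ *: _)]scalerA
      [t * h]mulrC.
  rewrite (derive_near _ x0 fh).
  by have [_ ->] := is_derive_cmul c (differentiable_is_derive v fd).
by rewrite deriveZdir // -mulrA => <-; rewrite mulKf.
Qed.

Lemma constant_on_segment f x y :
  (forall t, 0 <= t <= 1 -> x + t *: (y - x) != 0) ->
  (forall z v, z != 0 -> is_derive z v f 0) -> f y = f x.
Proof.
move=> xy f0.
have [|c _] := @mvt_line R _ f (fun=> 0) x (y - x) 1 ltr01.
  by move=> t /xy; exact: f0.
by rewrite mul0r scale1r subrKC => /eqP; rewrite subr_eq0 => /eqP.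
Qed.

End Rules.

(** * The standard forms and the Hodge star *)

Section Determinants.
Variable R : comNzRingType.
Implicit Types F G : nat -> nat -> R.

(** Entries come from a function on [nat], so that deleting a column is composition with [bump] and
    Laplace expansions can be iterated. *)
Definition detn n F : R := \det (\matrix_(a < n, b < n) F a b).

Lemma detnS n F : detn n.+1 F =
  \sum_(j < n.+1) F 0%N j * ((-1) ^+ j * detn n (fun a b => F a.+1 (bump j b))).
Proof.
rewrite /detn (expand_det_row _ ord0); apply: eq_bigr => j _.
rewrite mxE /cofactor add0n; congr (_ * (_ * \det _)).
by apply/matrixP => a b; rewrite !mxE.
Qed.

Lemma detn_delta n F j : (j < n.+1)%N ->
  (forall b, (b < n.+1)%N -> F 0%N b = (b == j)%:R) ->
  detn n.+1 F = (-1) ^+ j * detn n (fun a b => F a.+1 (bump j b)).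
Proof.
move=> jn F0; rewrite detnS (bigD1 (Ordinal jn)) //= F0 // eqxx mul1r.
rewrite big1 ?addr0 // => i ij; rewrite F0 // -[i == j :> nat]/(i == Ordinal jn).
by rewrite (negbTE ij) mul0r.
Qed.

Lemma detn3 F : detn 3 F = det3 (F 0%N) (F 1%N) (F 2%N) 0 1 2.
Proof.
rewrite detnS !big_ord_recl big_ord0 !detnS !big_ord_recl !big_ord0 /=.
rewrite !detnS !big_ord_recl !big_ord0 /= /detn !det_mx00 /bump /= /det3.
by rewrite !expr0 !expr1 ?exprS ?expr0; ring.
Qed.

Lemma detn4 F : detn 4 F = det4 (F 0%N) (F 1%N) (F 2%N) (F 3%N) 0 1 2 3.
Proof.
rewrite detnS !big_ord_recl big_ord0 !detn3 /= /bump /= /det4 /det3 /=.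
by rewrite !exprS !expr0; ring.
Qed.

End Determinants.

Section StandardForms.
Variable R : realType.

(** Indices run from 1 to 7 as in e^{ijk}, ordinals from 0, hence [l.-1]. The index 0 reads the same
    coordinate as 1, so comparisons are restricted to [0 < l < 8]. *)
Definition entry m (A : 'M[R]_(m.+1, 7)) (a l : nat) : R := A (inord a) (inord l.-1).

Lemma e3E (A : 'M[R]_(3, 7)) i j k :
  e_ [tuple i; j; k] A = det3 (entry A 0) (entry A 1) (entry A 2) i j k.
Proof.
rewrite /e_ -[RHS](detn3 (fun a b => entry A a (nth 0%N [:: i; j; k] b))).
congr (\det _); apply/matrixP => a b; rewrite !mxE /entry inord_val.
by rewrite (tnth_nth 0%N).
Qed.

Lemma e4E (A : 'M[R]_(4, 7)) i j k l :
  e_ [tuple i; j; k; l] A = detn 4 (fun a b => entry A a (nth 0%N [:: i; j; k; l] b)).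
Proof.
congr (\det _); apply/matrixP => a b; rewrite !mxE /entry inord_val.
by rewrite (tnth_nth 0%N).
Qed.

Lemma phi0E (A : 'M[R]_(3, 7)) : phi0 A = phi_of (entry A 0) (entry A 1) (entry A 2).
Proof. by rewrite /phi0 !e3E. Qed.

Lemma star_phi0E (A : 'M[R]_(4, 7)) :
  star_phi0 A = psi_of (entry A 0) (entry A 1) (entry A 2) (entry A 3).
Proof. by rewrite /star_phi0 !e4E !detn4. Qed.

End StandardForms.

Lemma eq_phi_of (R : comPzRingType) (u v w u' v' w' : nat -> R) :
  (forall l, (0 < l < 8)%N -> u l = u' l) -> (forall l, (0 < l < 8)%N -> v l = v' l) ->
  (forall l, (0 < l < 8)%N -> w l = w' l) -> phi_of u v w = phi_of u' v' w'.
Proof. by move=> hu hv hw; rewrite /phi_of /det3 !hu // !hv // !hw. Qed.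

Lemma eq_psi_of (R : comPzRingType) (u v w z u' v' w' z' : nat -> R) :
  (forall l, (0 < l < 8)%N -> u l = u' l) -> (forall l, (0 < l < 8)%N -> v l = v' l) ->
  (forall l, (0 < l < 8)%N -> w l = w' l) -> (forall l, (0 < l < 8)%N -> z l = z' l) ->
  psi_of u v w z = psi_of u' v' w' z'.
Proof. by move=> hu hv hw hz; rewrite /psi_of /det4 /det3 !hu // !hv // !hw // !hz. Qed.

Section Hodge.
Variable R : realType.

(** Expansion along three unit rows. Deleting column [i] moves [j] to [j.-1], and both deletions
    move [k] to [k.-2]; this gives the sign, and the nested [bump] lists the four columns that
    remain. *)
Lemma minor_delta (M : 'M[R]_(4, 7)) i j k : (i < j)%N -> (j < k)%N -> (k < 7)%N ->
  detn 7 (fun a b => if (a < 3)%N then (nth 0%N [:: i; j; k] a == b)%:R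
                     else entry M (a - 3) b.+1) =
  (-1) ^+ (i + j.-1 + k.-2) *
  let s b := (bump i (bump j.-1 (bump k.-2 b))).+1 in
  det4 (entry M 0) (entry M 1) (entry M 2) (entry M 3) (s 0%N) (s 1%N) (s 2%N) (s 3%N).
Proof.
move=> ij jk k7.
rewrite (@detn_delta _ 6 _ i) ?(leq_trans (ltn_trans ij jk)) //=; last 2 first.
- by lia.
- by move=> b _; rewrite eq_sym.
rewrite (@detn_delta _ 5 _ j.-1) //=; last 2 first.
- by lia.
- move=> b _; congr ((_ : bool)%:R); rewrite /bump; apply/eqP/eqP; lia.
rewrite (@detn_delta _ 4 _ k.-2) //=; last 2 first.
- by lia.
- move=> b _; congr ((_ : bool)%:R); rewrite /bump; apply/eqP/eqP; lia.
rewrite !mulrA -!exprD detn4 /= !subSS !subn0 /det4 /det3; congr (_ * _).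
Qed.

Lemma bigsum7 (P : pred nat) (F : nat -> R) :
  \sum_(j < 7 | P j) F j =
  (if P 0%N then F 0%N else 0) + (if P 1%N then F 1%N else 0)
  + (if P 2%N then F 2%N else 0) + (if P 3%N then F 3%N else 0)
  + (if P 4%N then F 4%N else 0) + (if P 5%N then F 5%N else 0)
  + (if P 6%N then F 6%N else 0).
Proof. by rewrite big_mkcond /= !big_ord_recl big_ord0 /= addr0 !addrA. Qed.

Lemma hodge_phi0 (B : 'M[R]_(7, 8)) (alpha : Defs.form R 3 8) (A : 'M[R]_(4, 8)) :
  (forall i j : 'I_7, dot (row i B) (row j B) = (i == j)%:R) ->
  (forall f : 'I_3 -> 'I_7, alpha (rowsub f B) = phi0 (coords B (rowsub f B))) ->
  hodge B alpha A = star_phi0 (coords B A).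
Proof.
move=> ortho alphaE; set M := coords B A.
pose G i j k : R := (phi_coef i.+1 j.+1 k.+1)%:~R *
  ((-1) ^+ (i + j.-1 + k.-2) *
  let s b := (bump i (bump j.-1 (bump k.-2 b))).+1 in
  det4 (entry M 0) (entry M 1) (entry M 2) (entry M 3) (s 0%N) (s 1%N) (s 2%N) (s 3%N)).
transitivity (\sum_(i < 7) \sum_(j < 7 | (i < j)%N) \sum_(k < 7 | (j < k)%N) G i j k).
  apply: eq_bigr => i _; apply: eq_bigr => j ij; apply: eq_bigr => k jk.
  rewrite /G -minor_delta // alphaE -phi_of_basis phi0E; congr (_ * _).
    have cfE a (f : 'I_3 -> 'I_7) l : (0 < l < 8)%N -> entry (coords B (rowsub f B)) a l =
      (l == (f (inord a)).+1)%:R.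
      move=> l8; rewrite /entry mxE row_rowsub ortho eq_sym -val_eqE /= inordK; last by lia.
      by congr ((_ : bool)%:R); apply/eqP/eqP; lia.
    by apply: eq_phi_of => l l8; rewrite cfE // (tnth_nth ord0) /= inordK.
  rewrite /vol /detn; congr (\det _); apply/matrixP => a b; rewrite !mxE.
  rewrite /entry /M !mxE.
  case: (splitP (a : 'I_(3 + 4))) => a' aE.
    rewrite (_ : row a _ = row (tnth [tuple i; j; k] a') B); last first.
      apply/rowP => l; rewrite !mxE (_ : a = lshift 4 a'); last exact: val_inj.
      by rewrite (unsplitK (inl a')) mxE.
    rewrite ortho aE (tnth_nth ord0).
    by case: a' aE => [[|[|[|?]]]].
  rewrite (_ : row a _ = row a' A); last first.
    apply/rowP => l; rewrite !mxE (_ : a = rshift 3 a'); last exact: val_inj.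
    by rewrite (unsplitK (inr a')).
  by rewrite aE addKn !inord_val.
rewrite (bigsum7 xpredT (fun i =>
  \sum_(j < 7 | (i < j)%N) \sum_(k < 7 | (j < k)%N) G i j k)) /=.
have S2 i := bigsum7 (fun j => (i < j)%N) (fun j => \sum_(k < 7 | (j < k)%N) G i j k).
have S3 i j := bigsum7 (fun k => (j < k)%N) (G i j).
rewrite !S2 !S3 /= ?addr0 ?add0r {S2 S3}.
rewrite /G star_phi0E /psi_of.
(* Of the 35 increasing triples only the seven terms of [phi] survive; their complements, with the
   signs of the shuffles, are the terms of [psi]. *)
repeat match goal with |- context [phi_coef ?a ?b ?c] =>
  let v := eval vm_compute in (phi_coef a b c) in change (phi_coef a b c) with v end.
rewrite ?[(Posz 0)%:~R](mulr0z 1) ?[(Posz 1)%:~R](mulr1z 1) ?[(Negz 0)%:~R](mulrN1z 1).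
rewrite !(mul0r, mul1r, mulN1r, addr0, add0r) /=.
repeat match goal with |- context [bump ?a ?b] =>
  let v := eval vm_compute in (bump a b) in change (bump a b) with v end.
rewrite -![(-1) ^+ (_ + _)]signr_odd /= !expr0 !mul1r.
by ring.
Qed.

End Hodge.

(** * Orthonormal frames *)

Section Dot.
Variables (R : realType) (n : nat).
Implicit Types (u v w x y : 'rV[R]_n) (c : R).

Lemma dotC u v : dot u v = dot v u.
Proof. by apply: eq_bigr => i _; rewrite mulrC. Qed.

Lemma dotDl u v w : dot (u + v) w = dot u w + dot v w.
Proof. by rewrite -big_split; apply: eq_bigr => i _; rewrite mxE mulrDl. Qed.

Lemma dotZl c u v : dot (c *: u) v = c * dot u v.
Proof. by rewrite mulr_sumr; apply: eq_bigr => i _; rewrite mxE mulrA. Qed.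

Lemma dotDr u v w : dot w (u + v) = dot w u + dot w v.
Proof. by rewrite ![dot w _]dotC dotDl. Qed.

Lemma dotZr c u v : dot v (c *: u) = c * dot v u.
Proof. by rewrite ![dot v _]dotC dotZl. Qed.

Lemma dotNl u v : dot (- u) v = - dot u v.
Proof. by rewrite -scaleN1r dotZl mulN1r. Qed.

Lemma dotNr u v : dot v (- u) = - dot v u.
Proof. by rewrite dotC dotNl dotC. Qed.

Lemma dot0l u : dot 0 u = 0.
Proof. by rewrite -(scale0r (0 : 'rV[R]_n)) dotZl mul0r. Qed.

Lemma dot_mulmx u v : dot u v = (u *m v^T) 0 0.
Proof. by rewrite mxE; apply: eq_bigr => i _; rewrite mxE. Qed.

Lemma dot_eq0 u : (dot u u == 0) = (u == 0).
Proof.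
rewrite psumr_eq0 => [|i _]; last by rewrite -expr2 sqr_ge0.
apply/allP/eqP => [h|-> i _]; last by rewrite mxE mulr0 eqxx.
apply/rowP => i; rewrite mxE; apply/eqP.
by have := h i (mem_index_enum i); rewrite /= -expr2 sqrf_eq0.
Qed.

Lemma dot_gt0 u : u != 0 -> 0 < dot u u.
Proof.
move=> u0; rewrite lt_def dot_eq0 u0 /=.
by apply: sumr_ge0 => i _; rewrite -expr2 sqr_ge0.
Qed.

Lemma enorm_gt0 u : u != 0 -> 0 < enorm u.
Proof. by move=> /dot_gt0; rewrite sqrtr_gt0. Qed.

Lemma enorm_sqr u : enorm u ^+ 2 = dot u u.
Proof.
rewrite sqr_sqrtr //; apply: sumr_ge0 => i _.
by rewrite -expr2 sqr_ge0.
Qed.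

End Dot.

Section DotDerive.
Variables (R : realType) (n : nat).
Implicit Types (u v w x y : 'rV[R]_n.+1) (c : R).

Lemma is_derive_dotl a x v : is_derive x v (fun y => dot a y) (dot a v).
Proof.
apply/is_derive_lineP.
have H : is_derive (0 : R) 1 (fun s : R => dot a x + dot a v * s) (0 + dot a v * 1).
  exact: is_derive_add (is_derive_const _ _ _) (is_derive_cmul _ (is_derive_id _ _)).
rewrite add0r mulr1 in H.
by apply: is_derive_ext H => s; rewrite dotDr dotZr mulrC.
Qed.

Lemma is_derive_coord j x v : is_derive x v (fun y => y 0 j) (v 0 j).
Proof.
have e (y : 'rV[R]_n.+1) : dot (delta_mx 0 j) y = y 0 j.
  rewrite /dot (bigD1 j) //= mxE !eqxx mul1r big1 ?addr0 // => i ij.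
  by rewrite mxE (negbTE ij) andbF mul0r.
have H := is_derive_dotl (delta_mx 0 j) x v; rewrite e in H.
exact: is_derive_ext e H.
Qed.

Lemma is_derive_dot x v : is_derive x v (fun y => dot y y) (2%:R * dot x v).
Proof.
apply/is_derive_lineP.
have H : is_derive (0 : R) 1 (fun s : R => dot x x + 2%:R * dot x v * s + dot v v * (s * s))
    (0 + 2%:R * dot x v * 1 + dot v v * (1 * (0 : R) + (0 : R) * 1)).
  exact: is_derive_add (is_derive_add (is_derive_const _ _ _)
    (is_derive_cmul _ (is_derive_id _ _)))
    (is_derive_cmul _ (is_derive_mul (is_derive_id _ _) (is_derive_id _ _))).
move: H; rewrite (_ : 0 + _ + _ = 2%:R * dot x v); last by ring.
by apply: is_derive_ext => s; rewrite !(dotDr, dotDl, dotZr, dotZl) [dot v x]dotC; ring.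
Qed.

Lemma is_derive_enorm_inv x v : x != 0 ->
  is_derive x v (fun y => (enorm y)^-1) (- (dot x v * (enorm x)^-1 ^+ 3)).
Proof.
move=> x0; apply/is_derive_lineP.
have e0 := enorm_gt0 x0; have d0 := dot_gt0 x0.
pose g (s : R) : R := dot (x + s *: v) (x + s *: v).
have g0 : g 0 = dot x x by rewrite /g scale0r addr0.
have Hg : is_derive (0 : R) 1 g (2%:R * dot x v).
  exact: (iffRL (is_derive_lineP (fun y => dot y y) x v _) (is_derive_dot x v)).
have Hs : is_derive (g 0) 1 Num.sqrt (2 * Num.sqrt (g 0))^-1.
  by apply: is_derive1_sqrt; rewrite g0.
have Hc := @is_derive1_comp _ _ _ _ _ _ Hs Hg.
have sx : Num.sqrt (g 0) = enorm x by rewrite g0.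
have Hi : is_derive (0 : R) 1 (fun s => ((Num.sqrt \o g) s)^-1)
   (- (enorm x) ^- 2 *: ((2 * Num.sqrt (g 0))^-1 * (2%:R * dot x v))).
  have [H1 H2] := Hc; split.
  - by apply: derivableV => //=; rewrite sx gt_eqF.
  - rewrite deriveV //=; last by rewrite sx gt_eqF.
    by move: H2; rewrite sx => ->.
move: Hi; rewrite (_ : - _ *: _ = - (dot x v * (enorm x)^-1 ^+ 3)) //.
by rewrite sx /GRing.scale /=; field; rewrite gt_eqF.
Qed.

End DotDerive.

Section Radial.
Variable R : realType.
Implicit Types (u v w x y : 'rV[R]_8) (A : 'M[R]_(3, 8)).

Lemma derive_radial y v : y != 0 ->
  'D_v (@radial R) y = (enorm y)^-1 *: (v - (dot y v / dot y y) *: y).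
Proof.
move=> y0; have e0 := enorm_gt0 y0.
have H i j : is_derive y v (fun z => radial z i j)
    ((enorm y)^-1 * (v 0 j - dot y v / dot y y * y 0 j)).
  rewrite ord1.
  have Hm := is_derive_mul (is_derive_enorm_inv v y0) (is_derive_coord j y v).
  have -> : (enorm y)^-1 * (v 0 j - dot y v / dot y y * y 0 j) =
     - (dot y v * (enorm y)^-1 ^+ 3) * y 0 j + (enorm y)^-1 * v 0 j.
    by rewrite -enorm_sqr; field; rewrite gt_eqF.
  by apply: is_derive_ext Hm => z; rewrite mxE.
rewrite derive_mx; last by apply/derivable_mxP => i j; have [] := H i j.
by apply/matrixP => i j; rewrite mxE; have [_ ->] := H i j; rewrite ord1 !mxE.
Qed.

Definition mat3 u v w : 'M[R]_(3, 8) := \matrix_(i < 3) nth 0 [:: u; v; w] i.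
Definition mat4 u v w z : 'M[R]_(4, 8) := \matrix_(i < 4) nth 0 [:: u; v; w; z] i.

Definition frame_coord (B : 'M[R]_(7, 8)) u (l : nat) : R := dot u (row (inord l.-1) B).

Lemma frame_coordD B u v :
  frame_coord B (u + v) = (fun l => frame_coord B u l + frame_coord B v l).
Proof. by apply/funext => l; exact: dotDl. Qed.

Lemma frame_coordZ B c u : frame_coord B (c *: u) = (fun l => c * frame_coord B u l).
Proof. by apply/funext => l; exact: dotZl. Qed.

Lemma row_mat3 u v w a : row (inord a) (mat3 u v w) = nth 0 [:: u; v; w] (inord a : 'I_3).
Proof. by rewrite rowK. Qed.

Lemma sphere_radial y : y != 0 -> sphere7 (radial y).
Proof.
move=> y0; rewrite /sphere7 /= /radial dotZl dotZr -enorm_sqr.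
by field; rewrite gt_eqF // enorm_gt0.
Qed.

Lemma phi_of_scale (c : R) (u v w : nat -> R) :
  phi_of (fun l => c * u l) (fun l => c * v l) (fun l => c * w l) = c ^+ 3 * phi_of u v w.
Proof. by rewrite /phi_of /det3; ring. Qed.

(** The differential of [radial] is [|y|^-1] times the projection orthogonal to [y]. The three slots
    give the cube, and the projection disappears because the frame is orthogonal to [y]. *)
Lemma pullback_radial_frame omega y B u v w : y != 0 -> g2_frame omega (radial y) B ->
  pullback (@radial R) omega y (mat3 u v w) =
  (enorm y)^-1 ^+ 3 * phi_of (frame_coord B u) (frame_coord B v) (frame_coord B w).
Proof.
move=> y0 [[Btan _] Bphi]; have e0 := enorm_gt0 y0; have d0 := dot_gt0 y0.
have By i : dot y (row i B) = 0.
  have := Btan i; rewrite /radial dotZl => /eqP; rewrite mulf_eq0 invr_eq0 gt_eqF //=.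
  by move=> /eqP.
rewrite /pullback Bphi; last first.
  move=> i; rewrite rowK derive_radial // /radial !(dotZl, dotZr, dotDr, dotNr).
  by rewrite divfK ?gt_eqF // subrr !mulr0.
rewrite phi0E -phi_of_scale; apply: eq_phi_of => l _;
  rewrite /entry mxE rowK derive_radial //;
  rewrite row_mat3 !(dotZl, dotDl, dotNl) By mulr0 subr0 inordK //.
Qed.

End Radial.

Lemma dot_rowE (R : realType) m n (Q : 'M[R]_(m, n)) (u : 'rV[R]_n) :
  u *m Q^T = \row_k dot u (row k Q).
Proof.
by apply/rowP => k; rewrite !mxE; apply: eq_bigr => i _; rewrite !mxE.
Qed.

Section Orthonormal.
Variables (R : realType) (n : nat) (Q : 'M[R]_n).
Hypothesis QQ : Q *m Q^T = 1%:M.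
Implicit Types (u v : 'rV[R]_n) (L : 'rV[R]_n -> R).

Lemma orthonormal_expand u : u = \sum_k dot u (row k Q) *: row k Q.
Proof.
rewrite -[LHS]mulmx1 -(mulmx1C QQ) mulmxA dot_rowE mulmx_sum_row.
by apply: eq_bigr => k _; rewrite mxE.
Qed.

Lemma orthonormal_parseval u v : dot u v = \sum_k dot u (row k Q) * dot v (row k Q).
Proof.
rewrite dot_mulmx -[u in LHS]mulmx1 -(mulmx1C QQ) mulmxA -mulmxA -{2}[Q]trmxK -trmx_mul.
by rewrite !dot_rowE mxE; apply: eq_bigr => k _; rewrite !mxE.
Qed.

Lemma orthonormal_linear L u :
  (forall u v, L (u + v) = L u + L v) -> (forall c u, L (c *: u) = c * L u) ->
  L u = \sum_k dot u (row k Q) * L (row k Q).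
Proof.
move=> LD LZ; have L0 : L 0 = 0 by rewrite -(scale0r 0) LZ mul0r.
rewrite {1}(orthonormal_expand u) (big_morph L LD L0).
by apply: eq_bigr => k _; rewrite LZ.
Qed.

End Orthonormal.

Lemma alternating4_proj (V : Type) (R : realType) (f : V -> V -> V -> V -> R) (p : V -> V) :
  (forall a b c d, f b a c d = - f a b c d) ->
  (forall a b c d, f a c b d = - f a b c d) ->
  (forall a b c d, f a b d c = - f a b c d) ->
  (forall a b c d, f a b c d = f (p a) b c d) ->
  forall a b c d, f a b c d = f (p a) (p b) (p c) (p d).
Proof.
move=> f12 f23 f34 P1.
have P2 a b c d : f a b c d = f a (p b) c d by rewrite f12 (P1 b) -f12.
have P3 a b c d : f a b c d = f a b (p c) d by rewrite f23 (P2 _ c) -f23.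
have P4 a b c d : f a b c d = f a b c (p d) by rewrite f34 (P3 _ _ d) -f34.
by move=> a b c d; rewrite P1 P2 P3 P4.
Qed.

Lemma alternating3_linear (R : realType) (V : lmodType R) (f : V -> V -> V -> R) :
  (forall u v w, f v u w = - f u v w) -> (forall u v w, f u w v = - f u v w) ->
  (forall u u' v w, f (u + u') v w = f u v w + f u' v w) ->
  (forall r u v w, f (r *: u) v w = r * f u v w) ->
  [/\ forall u v w, f u v w = - f w v u,
    forall u v w w', f u v (w + w') = f u v w + f u v w' &
    forall u v r w, f u v (r *: w) = r * f u v w].
Proof.
move=> f12 f23 fD fZ.
have f13 u v w : f u v w = - f w v u by rewrite (f12 v u) (f23 v w) (f12 w v) opprK.
split=> // [u v w w'|u v r w]; rewrite f13.
  by rewrite fD opprD -!f13.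
by rewrite fZ -mulrN -f13.
Qed.

(** A trace does not depend on the orthonormal basis. This replaces the adapted frame, which varies
    with the point in an uncontrolled way, by a fixed basis over which the contraction can be
    differentiated. *)
Lemma orthonormal_trace (R : realType) n (Q Q' : 'M[R]_n) (L L' : 'rV[R]_n -> R) :
  Q *m Q^T = 1%:M -> Q' *m Q'^T = 1%:M ->
  (forall u v, L (u + v) = L u + L v) -> (forall c u, L (c *: u) = c * L u) ->
  (forall u v, L' (u + v) = L' u + L' v) -> (forall c u, L' (c *: u) = c * L' u) ->
  \sum_k L (row k Q) * L' (row k Q) = \sum_k L (row k Q') * L' (row k Q').
Proof.
move=> QQ QQ' LD LZ LD' LZ'.
under eq_bigr => k _ do rewrite (orthonormal_linear QQ' (row k Q) LD LZ) mulr_suml.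
rewrite exchange_big; apply: eq_bigr => j _ /=.
rewrite (orthonormal_linear QQ (row j Q') LD' LZ') mulr_sumr.
by apply: eq_bigr => k _; rewrite dotC; ring.
Qed.

Section Frame.
Variables (R : realType) (x : 'rV[R]_8) (B : 'M[R]_(7, 8)).

Definition adapted : 'M[R]_8 := col_mx x B.

Lemma adapted_sum (F : 'rV[R]_8 -> R) :
  \sum_k F (row k adapted) = F x + sum7 (fun l => F (row (inord l.-1) B)).
Proof.
rewrite /adapted (@big_split_ord _ _ _ 1 7) /= big_ord1.
rewrite (@rowKu _ 1 7) row_id; congr (_ + _).
under eq_bigr => l _ do rewrite (@rowKd _ 1 7).
rewrite !big_ord_recl big_ord0 /sum7 addr0 !addrA.
by do !congr (_ + _); congr (F (row _ B)); apply: val_inj; rewrite /= inordK.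
Qed.

Lemma adapted_orthonormal : sphere7 x -> orthonormal_frame x B ->
  adapted *m adapted^T = 1%:M.
Proof.
move=> x1 [Btan Bort]; rewrite /adapted (@tr_col_mx _ 1 7 8) (@mul_col_row _ 1 7 8 1 7).
have -> : x *m x^T = 1%:M.
  by apply/matrixP => i j; rewrite !ord1 -dot_mulmx x1 mxE eqxx.
have BB : B *m B^T = 1%:M.
  apply/matrixP => i j; rewrite !mxE -Bort; apply: eq_bigr => k _; by rewrite !mxE.
have xB : x *m B^T = 0.
  by rewrite dot_rowE; apply/rowP => k; rewrite !mxE Btan.
have -> : B *m x^T = 0 by rewrite -[B]trmxK -trmx_mul xB trmx0.
by rewrite BB xB -scalar_mx_block.
Qed.

Lemma adapted_dot a c : sphere7 x -> orthonormal_frame x B ->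
  dot a c = dot a x * dot c x + sum7 (fun l => frame_coord B a l * frame_coord B c l).
Proof.
move=> x1 fB; rewrite (orthonormal_parseval (adapted_orthonormal x1 fB)).
by rewrite (adapted_sum (fun q => dot a q * dot c q)).
Qed.

Lemma adapted_basis l : (0 < l < 8)%N -> orthonormal_frame x B ->
  forall m, (0 < m < 8)%N -> frame_coord B (row (inord l.-1) B) m = basis_vec R l m.
Proof.
move=> l8 [_ Bort] m m8; rewrite /frame_coord Bort -val_eqE /= !inordK; try lia.
by rewrite /basis_vec eq_sym; congr ((_ : bool)%:R); apply/eqP/eqP; lia.
Qed.

End Frame.

(** * The radial extension of the form *)

Section Cone.
Variables (R : realType) (omega : diff_form R 3 8) (tau : R).
Hypothesis np : nearly_parallel omega tau.
Implicit Types (a b c d e u v w x y z : 'rV[R]_8) (t : R).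

(* These definitions are locked because the conversion test may otherwise unfold
   the derivatives of [omega]. *)
Definition cone_form y u v w : R := locked (pullback (@radial R) omega y (mat3 u v w)).
Local Notation eta := cone_form.
Definition cone_derive y u v w z : R := locked ('D_u (fun p => eta p v w z) y).
Local Notation Deta := cone_derive.
Definition cone_derive2 y e u v w z : R := locked ('D_e (fun p => Deta p u v w z) y).
Local Notation DDeta := cone_derive2.
Definition cone_d y a b c d : R :=
  Deta y a b c d - Deta y b a c d + Deta y c a b d - Deta y d a b c.
Local Notation deta := cone_d.

Lemma etaF u v w :
  (fun y => eta y u v w) = (fun y => pullback (@radial R) omega y (mat3 u v w)).
Proof. by apply/funext => y; rewrite /cone_form -lock. Qed.

Lemma DetaE y u v w z : Deta y u v w z = 'D_u (fun p => eta p v w z) y.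
Proof. by rewrite /cone_derive -lock. Qed.

Lemma DetaF u v w z : (fun y => Deta y u v w z) = 'D_u (fun p => eta p v w z).
Proof. by apply/funext => y; exact: DetaE. Qed.

Lemma DDetaF y e u v w z : DDeta y e u v w z = 'D_e (fun p => Deta p u v w z) y.
Proof. by rewrite /cone_derive2 -lock. Qed.

Lemma radial_frame y : y != 0 -> exists2 B, g2_frame omega (radial y) B &
  forall A : 'M[R]_(4, 8), tangent (radial y) A ->
    sphere_d omega (radial y) A = tau * hodge B (omega (radial y)) A.
Proof. by case: np => _ _ + y0; apply; exact: sphere_radial. Qed.

Lemma etaE y : y != 0 -> exists2 B, orthonormal_frame (radial y) B &
  forall u v w, eta y u v w = (enorm y)^-1 ^+ 3 * phi_of (frame_coord B u) (frame_coord B v)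
    (frame_coord B w).
Proof.
move=> y0; have [B fB _] := radial_frame y0; exists B; first by have [] := fB.
by move=> u v w; rewrite /cone_form -lock; exact: pullback_radial_frame.
Qed.

Lemma etaS12 y u v w : y != 0 -> eta y v u w = - eta y u v w.
Proof. by move=> /etaE[B _ h]; rewrite !h phi_of_swap12 mulrN. Qed.

Lemma etaS23 y u v w : y != 0 -> eta y u w v = - eta y u v w.
Proof. by move=> /etaE[B _ h]; rewrite !h phi_of_swap23 mulrN. Qed.

Lemma etaDl y u u' v w : y != 0 -> eta y (u + u') v w = eta y u v w + eta y u' v w.
Proof.
move=> /etaE[B _ h]; rewrite !h -mulrDr; congr (_ * _).
by rewrite frame_coordD phi_ofDl.
Qed.

Lemma etaZl y r u v w : y != 0 -> eta y (r *: u) v w = r * eta y u v w.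
Proof.
move=> /etaE[B _ h]; rewrite !h mulrCA; congr (_ * _).
by rewrite frame_coordZ phi_ofZl.
Qed.

Lemma eta_radial y v w : y != 0 -> eta y y v w = 0.
Proof.
move=> y0; have [B [Btan _] h] := etaE y0; have e0 := enorm_gt0 y0.
rewrite h [phi_of _ _ _](_ : _ = 0) ?mulr0 //.
have c0 : frame_coord B y = (fun l => 0 * 0).
  apply/funext => l; rewrite mulr0.
  have := Btan (inord l.-1); rewrite /radial dotZl => /eqP.
  by rewrite mulf_eq0 invr_eq0 gt_eqF //= => /eqP.
by rewrite c0 phi_ofZl mul0r.
Qed.

Lemma scale_neq0 t y : 0 < t -> y != 0 -> t *: y != 0.
Proof. by move=> t0 y0; rewrite scaler_eq0 gt_eqF. Qed.

Lemma enormZ t y : 0 < t -> enorm (t *: y) = t * enorm y.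
Proof.
move=> t0; rewrite /enorm dotZl dotZr mulrA -expr2 sqrtrM ?sqr_ge0 //.
by rewrite sqrtr_sqr ger0_norm // ltW.
Qed.

Lemma radialZ t y : 0 < t -> radial (t *: y) = radial y.
Proof.
move=> t0; rewrite /radial enormZ // scalerA invfM mulrAC mulVf ?mul1r //.
by rewrite gt_eqF.
Qed.

Lemma etaZ t y u v w : 0 < t -> y != 0 -> eta (t *: y) u v w = t^-1 ^+ 3 * eta y u v w.
Proof.
move=> t0 y0; have [B fB _] := radial_frame y0.
rewrite /cone_form -2!lock (pullback_radial_frame u v w y0 fB).
rewrite (pullback_radial_frame _ _ _ (scale_neq0 t0 y0) (B := B)) ?radialZ //.
by rewrite enormZ // invfM exprMn mulrA.
Qed.

Lemma eta_smooth u v w : smooth_on [set y | y != 0] (fun y => eta y u v w).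
Proof. by rewrite etaF; case: np => -[sm _] _ _; exact: sm. Qed.

Lemma eta_diff y u v w : y != 0 -> differentiable (fun p => eta p u v w) y.
Proof. exact: (@eta_smooth u v w [::]). Qed.

Lemma Deta_diff y u v w z : y != 0 -> differentiable (fun p => Deta p u v w z) y.
Proof. by move=> y0; rewrite (DetaF u v w z); exact: (@eta_smooth v w z [:: u]). Qed.

Lemma is_derive_eta y u v w z : y != 0 ->
  is_derive y u (fun p => eta p v w z) (Deta y u v w z).
Proof. by move=> y0; rewrite DetaE; apply: differentiable_is_derive; exact: eta_diff. Qed.

Lemma is_derive_Deta y e u v w z : y != 0 ->
  is_derive y e (fun p => Deta p u v w z) (DDeta y e u v w z).
Proof. by move=> y0; rewrite DDetaF; apply: differentiable_is_derive; exact: Deta_diff. Qed.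

Lemma DDeta_schwarz y e u v w z : y != 0 ->
  DDeta y e u v w z = DDeta y u e v w z.
Proof.
move=> y0.
have E e' u' : DDeta y e' u' v w z = 'D_e' ('D_u' (fun p => eta p v w z)) y.
  exact: etrans (DDetaF y e' u' v w z) (congr1 (fun g => 'D_e' g y) (DetaF u' v w z)).
exact: etrans (E e u) (etrans (schwarz e u open_nonzero y0 (@eta_smooth v w z))
  (esym (E u e))).
Qed.

Lemma DetaD0 y u u' v w z : y != 0 ->
  Deta y (u + u') v w z = Deta y u v w z + Deta y u' v w z.
Proof. by move=> y0; rewrite !DetaE deriveDdir //; exact: eta_diff. Qed.

Lemma DetaZ0 y r u v w z : y != 0 -> Deta y (r *: u) v w z = r * Deta y u v w z.
Proof. by move=> y0; rewrite !DetaE deriveZdir //; exact: eta_diff. Qed.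

Lemma Deta_congr y u v w z (g : 'rV[R]_8 -> R) dg : y != 0 -> is_derive y u g dg ->
  (forall p, p != 0 -> g p = eta p v w z) -> Deta y u v w z = dg.
Proof.
by move=> y0 hg ge; have [_ <-] := hg; rewrite DetaE; apply: derive_near => // p /ge.
Qed.

Lemma DetaS12 y u v w z : y != 0 -> Deta y u w v z = - Deta y u v w z.
Proof.
move=> y0; rewrite -mulN1r.
apply: (Deta_congr y0 (is_derive_cmul (-1) (is_derive_eta u v w z y0))) => p p0.
by rewrite mulN1r (etaS12 v w).
Qed.

Lemma DetaS23 y u v w z : y != 0 -> Deta y u v z w = - Deta y u v w z.
Proof.
move=> y0; rewrite -mulN1r.
apply: (Deta_congr y0 (is_derive_cmul (-1) (is_derive_eta u v w z y0))) => p p0.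
by rewrite mulN1r (etaS23 v w).
Qed.

Lemma DetaDl y u v v' w z : y != 0 ->
  Deta y u (v + v') w z = Deta y u v w z + Deta y u v' w z.
Proof.
move=> y0; apply: (Deta_congr y0
  (is_derive_add (is_derive_eta u v w z y0) (is_derive_eta u v' w z y0))) => p p0.
by rewrite etaDl.
Qed.

Lemma DetaZl y r u v w z : y != 0 -> Deta y u (r *: v) w z = r * Deta y u v w z.
Proof.
move=> y0; apply: (Deta_congr y0 (is_derive_cmul r (is_derive_eta u v w z y0))) => p p0.
by rewrite etaZl.
Qed.

Lemma DetaZ t y u v w z : 0 < t -> y != 0 ->
  Deta (t *: y) u v w z = t^-1 ^+ 4 * Deta y u v w z.
Proof.
move=> t0 y0; rewrite !DetaE (derive_dilation u (c := t^-1 ^+ 3)) ?gt_eqF //.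
- exact: eta_diff (scale_neq0 t0 y0).
- exact: eta_diff.
- by move=> p p0; rewrite etaZ.
Qed.

Lemma row_mat4 a b c d i :
  row' i (mat4 a b c d) = let s := [:: a; b; c; d] in
    mat3 (nth 0 s (bump i 0)) (nth 0 s (bump i 1)) (nth 0 s (bump i 2)).
Proof.
apply/matrixP => k j; rewrite !mxE /=.
by case: k => [[|[|[|?]]]].
Qed.

Lemma sphere_dE x a b c d : sphere_d omega x (mat4 a b c d) = deta x a b c d.
Proof.
pose F u v w z := 'D_u (fun y => pullback (@radial R) omega y (mat3 v w z)) x.
have E u v w z : F u v w z = Deta x u v w z.
  exact: etrans (congr1 (fun g => 'D_u g x) (esym (etaF v w z))) (esym (DetaE x u v w z)).
rewrite /sphere_d /ext_derive !big_ord_recl big_ord0 !row_mat4 !rowK /= /bump /=.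
transitivity ((-1) ^+ 0 * F a b c d + ((-1) ^+ 1 * F b a c d +
  ((-1) ^+ 2 * F c a b d + ((-1) ^+ 3 * F d a b c + 0)))) => //.
rewrite !E /cone_d.
move: (Deta x a b c d) (Deta x b a c d) (Deta x c a b d) (Deta x d a b c) => p q r s.
by ring.
Qed.

Ltac atoms_ring :=
  repeat match goal with
  | |- context [Deta ?y ?a ?b ?c ?d] => move: (Deta y a b c d) => ?
  | |- context [eta ?y ?a ?b ?c] => move: (eta y a b c) => ?
  | |- context [dot ?x ?y] => move: (dot x y) => ?
  end; ring.

Lemma detaZ t y a b c d : 0 < t -> y != 0 ->
  deta (t *: y) a b c d = t^-1 ^+ 4 * deta y a b c d.
Proof. by move=> t0 y0; rewrite /cone_d !DetaZ //; atoms_ring. Qed.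

Lemma detaS12 y a b c d : y != 0 -> deta y b a c d = - deta y a b c d.
Proof.
move=> y0; rewrite /cone_d (DetaS12 c a b) // (DetaS12 d a b) //; atoms_ring.
Qed.

Lemma detaS23 y a b c d : y != 0 -> deta y a c b d = - deta y a b c d.
Proof.
move=> y0; rewrite /cone_d (DetaS12 a b c) // (DetaS23 d a b) //; atoms_ring.
Qed.

Lemma detaS34 y a b c d : y != 0 -> deta y a b d c = - deta y a b c d.
Proof.
move=> y0; rewrite /cone_d (DetaS23 a b c) // (DetaS23 b a c) //; atoms_ring.
Qed.

Lemma detaDl y a a' b c d : y != 0 ->
  deta y (a + a') b c d = deta y a b c d + deta y a' b c d.
Proof. by move=> y0; rewrite /cone_d DetaD0 // !DetaDl //; atoms_ring. Qed.

Lemma detaZl y r a b c d : y != 0 -> deta y (r *: a) b c d = r * deta y a b c d.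
Proof. by move=> y0; rewrite /cone_d DetaZ0 // !DetaZl //; atoms_ring. Qed.

Lemma eta_expand (Q : 'M[R]_8) y u v w : y != 0 -> Q *m Q^T = 1%:M ->
  eta y u v w = \sum_k dot u (row k Q) * eta y (row k Q) v w.
Proof.
move=> y0 QQ.
by apply: (@orthonormal_linear _ _ _ QQ (fun u => eta y u v w)) => *; rewrite ?etaDl ?etaZl.
Qed.

Lemma Deta_expand (Q : 'M[R]_8) y e u v w : y != 0 -> Q *m Q^T = 1%:M ->
  Deta y e u v w = \sum_k dot u (row k Q) * Deta y e (row k Q) v w.
Proof.
move=> y0 QQ.
by apply: (@orthonormal_linear _ _ _ QQ (fun u => Deta y e u v w)) => *;
  rewrite ?DetaDl ?DetaZl.
Qed.

(** Product rule applied to [eta_radial]. The first argument moves with the base point, so it is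
    first expanded in the fixed standard basis. *)
Lemma Deta_contract y u w z : y != 0 -> Deta y u y w z = - eta y u w z.
Proof.
move=> y0; have Q1 : (1%:M : 'M[R]_8) *m 1%:M^T = 1%:M by rewrite trmx1 mulmx1.
pose r k : 'rV[R]_8 := row k 1%:M.
have H : is_derive y u (fun p => \sum_k dot p (r k) * eta p (r k) w z)
    (\sum_k (dot u (r k) * eta y (r k) w z + dot y (r k) * Deta y u (r k) w z)).
  apply: is_derive_bigsum => k; apply: is_derive_mul; last exact: is_derive_eta.
  have H := is_derive_dotl (r k) y u; rewrite dotC in H.
  by apply: is_derive_ext H => p; rewrite dotC.
have [_ E1] : is_derive y u (fun=> 0 : R) (eta y u w z + Deta y u y w z).
  rewrite (eta_expand u _ _ y0 Q1) (Deta_expand _ y _ _ y0 Q1) -big_split /=.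
  by apply: (is_derive_near y0 _ H) => p p0; rewrite -(eta_expand p w z p0 Q1) eta_radial.
have [_ E2] := is_derive_const (0 : R) y u.
by apply/eqP; rewrite -addr_eq0 addrC -E1 E2.
Qed.

(** Euler's identity in degree -3: [(1 + s)^3 eta] at [(1 + s) y] does not depend on s near 0. *)
Lemma Deta_euler y v w z : y != 0 -> Deta y y v w z = - (3%:R * eta y v w z).
Proof.
move=> y0; pose f (s : R) := eta (y + s *: y) v w z.
have Hf : is_derive (0 : R) 1 f (Deta y y v w z).
  exact: (iffRL (is_derive_lineP (fun p => eta p v w z) y y _) (is_derive_eta y v w z y0)).
have H1 : is_derive (0 : R) 1 (fun s : R => 1 + s) (0 + 1).
  exact: is_derive_add (is_derive_const _ _ _) (is_derive_id _ _).
have H := is_derive_mul (is_derive_mul H1 (is_derive_mul H1 H1)) Hf.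
have H0 : is_derive (0 : R) 1 (fun s : R => (1 + s) * ((1 + s) * (1 + s)) * f s) 0.
  apply: (near_eq_is_derive _ (is_derive_const (eta y v w z) (0 : R) (1 : R))).
  near=> s; have s1 : 0 < 1 + s.
    rewrite -ltrBlDl sub0r; near: s; apply: open_nbhs_nbhs; split; first exact: open_gt.
    by rewrite /= oppr_lt0.
  rewrite /f (_ : y + s *: y = (1 + s) *: y); last by rewrite scalerDl scale1r.
  rewrite etaZ //; move: (eta y v w z) => r; have s0 : 1 + s != 0 by rewrite gt_eqF.
  by field.
have [_ E1] := H; have [_ E2] := H0.
move: E1; rewrite E2 addr0 /f scale0r addr0 => /esym E.
move: E; move: (eta _ _ _ _) (Deta _ _ _ _ _) => p q E; lra.
Unshelve. all: by end_near. Qed.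

(** The Euler term contributes [- 3 eta] and each of the three contractions [+ eta], as befits the
    derivative of a pullback by [radial]. *)
Lemma deta_radial y b c d : y != 0 -> deta y y b c d = 0.
Proof.
move=> y0; rewrite /cone_d Deta_euler // !Deta_contract //.
rewrite (etaS12 b c) // (etaS12 b d) // (etaS23 b c) //.
by atoms_ring.
Qed.

Lemma sphere_neq0 x : sphere7 x -> x != 0.
Proof. by move=> x1; rewrite -dot_eq0 x1 oner_eq0. Qed.

Lemma enorm_sphere x : sphere7 x -> enorm x = 1.
Proof. by rewrite /enorm => ->; rewrite sqrtr1. Qed.

Lemma radial_sphere x : sphere7 x -> radial x = x.
Proof. by move=> x1; rewrite /radial enorm_sphere // invr1 scale1r. Qed.

Definition proj x a := a - dot x a *: x.

Lemma dot_proj x a : sphere7 x -> dot x (proj x a) = 0.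
Proof. by move=> x1; rewrite /proj dotDr dotNr dotZr x1 mulr1 subrr. Qed.

Lemma deta_proj x a b c d : sphere7 x ->
  deta x a b c d = deta x (proj x a) (proj x b) (proj x c) (proj x d).
Proof.
move=> x1; have x0 := sphere_neq0 x1.
have P a' b' c' d' : deta x a' b' c' d' = deta x (proj x a') b' c' d'.
  by rewrite /proj -scaleNr detaDl // detaZl // deta_radial // mulr0 addr0.
apply: (alternating4_proj (f := deta x) (p := proj x)) => // *;
  [exact: detaS12|exact: detaS23|exact: detaS34].
Qed.

(** The hypotheses concern tangent vectors only. Both [eta] and [deta] ignore the component along
    [x], and so do frame coordinates, so the formulas hold for all vectors of R^8. *)
Lemma sphere_frame x : sphere7 x -> exists B, [/\ g2_frame omega x B,
  forall u v w, eta x u v w = phi_of (frame_coord B u) (frame_coord B v) (frame_coord B w) &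
  forall a b c d, deta x a b c d =
    tau * psi_of (frame_coord B a) (frame_coord B b) (frame_coord B c) (frame_coord B d)].
Proof.
move=> x1; have x0 := sphere_neq0 x1; have [B fB dB] := radial_frame x0.
have h u v w : eta x u v w = phi_of (frame_coord B u) (frame_coord B v) (frame_coord B w).
  by rewrite /cone_form -lock (pullback_radial_frame _ _ _ x0 fB) enorm_sphere // invr1
    expr1n mul1r.
rewrite radial_sphere // in fB dB; exists B; split=> // a b c d.
have [[Btan Bort] Bphi] := fB.
have coP u : frame_coord B (proj x u) = frame_coord B u.
  by apply/funext => l; rewrite /frame_coord /proj dotDl dotNl dotZl Btan mulr0 subr0.
rewrite deta_proj // -sphere_dE dB; last first.
  by move=> i; rewrite rowK; case: i => [[|[|[|[|?]]]]] //= _; rewrite dot_proj.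
rewrite (hodge_phi0 _ Bort) => [|f]; last first.
  by apply: Bphi => i; rewrite row_rowsub.
congr (_ * _); rewrite star_phi0E.
transitivity (psi_of (frame_coord B (proj x a)) (frame_coord B (proj x b))
  (frame_coord B (proj x c)) (frame_coord B (proj x d)));
  last by rewrite !coP.
by apply: eq_psi_of => l _; rewrite /entry mxE rowK inordK.
Qed.

(** The contraction identity in an adapted frame, freed of the frame: the trace runs over any [Q],
    [psi] is [tau^-1] times [deta], and the inner product of the projections to the tangent space is
    [dot a c - dot x a * dot x c]. *)
Lemma eta_sum (Q : 'M[R]_8) x a b c d : sphere7 x -> Q *m Q^T = 1%:M ->
  \sum_k eta x a b (row k Q) * eta x c d (row k Q) =
  (dot a c - dot x a * dot x c) * (dot b d - dot x b * dot x d)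
  - (dot a d - dot x a * dot x d) * (dot b c - dot x b * dot x c)
  + tau^-1 * deta x a b c d.
Proof.
move=> x1 QQ; have x0 := sphere_neq0 x1; have [B [[fB _] h hd]] := sphere_frame x1.
have [S13 eta3D eta3Z] := alternating3_linear (fun u v w => etaS12 u v w x0)
  (fun u v w => etaS23 u v w x0) (fun u u' v w => etaDl u u' v w x0)
  (fun r u v w => etaZl r u v w x0).
rewrite (orthonormal_trace QQ (adapted_orthonormal x1 fB) (eta3D a b)
  (eta3Z a b) (eta3D c d) (eta3Z c d)).
rewrite (adapted_sum x B (fun q => eta x a b q * eta x c d q)).
have -> : eta x a b x = 0 by rewrite S13 (eta_radial _ _ x0) oppr0.
rewrite mul0r add0r hd mulKf; last by case: np.
have dE u v : dot u v - dot x u * dot x v =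
  sum7 (fun l => frame_coord B u l * frame_coord B v l).
  by rewrite (adapted_dot u v x1 fB) [dot u x]dotC [dot v x]dotC addrC addKr.
rewrite !dE -phi_of_contract /sum7.
have hq u v l : (0 < l < 8)%N -> eta x u v (row (inord l.-1) B) =
  phi_of (frame_coord B u) (frame_coord B v) (basis_vec R l).
  by move=> l8; rewrite h; apply: eq_phi_of => // m m8; rewrite (@adapted_basis _ x).
by do !congr (_ + _); rewrite !hq.
Qed.

End Cone.

(** * The covariant derivative of [omega] *)

Section TangentialDerivatives.
Variables (R : realType) (n : nat) (x e : 'rV[R]_n.+1).
Hypotheses (x1 : dot x x = 1) (xe : dot x e = 0).
Implicit Types (a c : 'rV[R]_n.+1) (f : 'rV[R]_n.+1 -> R) (df : R).

Lemma is_derive_dotX k : is_derive x e (fun p => dot p p ^+ k) 0.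
Proof.
elim: k => [|k IH].
  by apply: is_derive_ext (is_derive_const 1 x e) => p; rewrite expr0.
have := is_derive_mul (is_derive_dot x e) IH.
by rewrite xe mulr0 mul0r mulr0 addr0; apply: is_derive_ext => p; rewrite exprS.
Qed.

Lemma is_derive_dotX_mul k f df : is_derive x e f df ->
  is_derive x e (fun p => dot p p ^+ k * f p) df.
Proof.
move=> hf; have := is_derive_mul (is_derive_dotX k) hf.
by rewrite mul0r add0r x1 expr1n mul1r.
Qed.

Lemma is_derive_dotr a : is_derive x e (fun p => dot p a) (dot e a).
Proof.
have := is_derive_dotl a x e; rewrite [dot a e]dotC.
by apply: is_derive_ext => p; exact: dotC.
Qed.

(** The product [dot p a * dot p c] vanishes to second order at [x], and [dot p p] is stationary in
    tangential directions. *)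
Lemma is_derive_gram a c : dot x a = 0 -> dot x c = 0 ->
  is_derive x e (fun p => dot p p * dot a c - dot p a * dot p c) 0.
Proof.
move=> xa xc; have := is_derive_sub
  (is_derive_mul (is_derive_dot x e) (is_derive_const (dot a c) x e))
  (is_derive_mul (is_derive_dotr a) (is_derive_dotr c)).
by rewrite xe xa xc !(mulr0, mul0r, addr0, subr0).
Qed.

End TangentialDerivatives.

Lemma eq_sum7 (R : comPzRingType) (F G : nat -> R) :
  (forall l, (0 < l < 8)%N -> F l = G l) -> sum7 F = sum7 G.
Proof. by move=> FG; rewrite /sum7 !FG. Qed.

Lemma sum7D (R : comPzRingType) (F G : nat -> R) :
  sum7 (fun l => F l + G l) = sum7 F + sum7 G.
Proof. by rewrite /sum7; ring. Qed.

(* [d (d eta) = 0] in terms of symmetric second derivatives. *)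
Lemma d_squared (R : realType) (V : Type) (f : V -> V -> V -> V -> V -> R) :
  (forall e u v w z, f e u v w z = f u e v w z) ->
  let g e a b c d := f e a b c d - f e b a c d + f e c a b d - f e d a b c in
  forall e a b c d,
  g e a b c d - g a e b c d + g b e a c d - g c e a b d + g d e a b c = 0.
Proof.
move=> S g e a b c d; rewrite /g.
rewrite (S a e) (S b e) (S b a) (S c e) (S c a) (S c b) (S d e) (S d a) (S d b) (S d c).
by ring.
Qed.

Lemma d_repeated (R : realType) (V : Type) (f : V -> V -> V -> V -> R) :
  (forall u v w z, f u w v z = - f u v w z) -> (forall u v w z, f u v z w = - f u v w z) ->
  forall a b c, f a b c b - f b a c b + f c a b b - f b a b c = 0.
Proof.
move=> S12 S23 a b c.
have f0 u v w : f u v w w = 0 by have := S23 u v w w; lra.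
by rewrite (S23 a b b c) (S12 a b b c) (S23 b a b c) f0; have := S12 a b b c; lra.
Qed.

Section Torsion.
Variables (R : realType) (omega : diff_form R 3 8) (tau : R).
Hypothesis np : nearly_parallel omega tau.
Implicit Types (a b c d e u v w x y z p : 'rV[R]_8) (t : R).
Local Notation eta := (cone_form omega).
Local Notation Deta := (cone_derive omega).
Local Notation deta := (cone_d omega).

Local Notation DDeta := (cone_derive2 omega).

Lemma is_derive_deta y e a b c d : y != 0 ->
  is_derive y e (fun p => deta p a b c d)
    (DDeta y e a b c d - DDeta y e b a c d + DDeta y e c a b d - DDeta y e d a b c).
Proof.
move=> y0; have H u v w z := is_derive_Deta np e u v w z y0.
exact: is_derive_sub (is_derive_add (is_derive_sub (H _ _ _ _) (H _ _ _ _)) (H _ _ _ _))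
  (H _ _ _ _).
Qed.

Lemma DDetaN y e u v w z v' w' z' : y != 0 ->
  (forall p, p != 0 -> Deta p u v' w' z' = - Deta p u v w z) ->
  DDeta y e u v' w' z' = - DDeta y e u v w z.
Proof.
move=> y0 h; rewrite -mulN1r {1}DDetaF.
have [_ <-] := is_derive_cmul (-1) (is_derive_Deta np e u v w z y0).
by apply: derive_near => // p hp; rewrite h // mulN1r.
Qed.

Lemma DDetaS12 y e u v w z : y != 0 -> DDeta y e u w v z = - DDeta y e u v w z.
Proof. by move=> y0; exact: (DDetaN e y0 (fun p hp => DetaS12 np u v w z hp)). Qed.

Lemma DDetaS23 y e u v w z : y != 0 -> DDeta y e u v z w = - DDeta y e u v w z.
Proof. by move=> y0; exact: (DDetaN e y0 (fun p hp => DetaS23 np u v w z hp)). Qed.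

Lemma radial_decompose p : p != 0 -> p = enorm p *: radial p.
Proof.
by move=> p0; rewrite /radial scalerA mulfV ?scale1r // gt_eqF // enorm_gt0.
Qed.

(** An identity on the sphere alone cannot be differentiated in R^8. With t = |p|, the sum has
    degree -6 and [deta] degree -4; the powers of [dot p p] make each term t^4 times its value at
    [radial p], and no square root is left. *)
Lemma eta_sum_nonzero (Q : 'M[R]_8) p a b c d : p != 0 -> Q *m Q^T = 1%:M ->
  dot p p ^+ 5 * (\sum_k eta p a b (row k Q) * eta p c d (row k Q)) =
  (dot p p * dot a c - dot p a * dot p c) * (dot p p * dot b d - dot p b * dot p d)
  - (dot p p * dot a d - dot p a * dot p d) * (dot p p * dot b c - dot p b * dot p c)
  + tau^-1 * (dot p p ^+ 4 * deta p a b c d).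
Proof.
move=> p0 QQ; have t0 := enorm_gt0 p0; have r1 := sphere_radial p0.
have r0 := sphere_neq0 r1.
have E := eta_sum np a b c d r1 QQ; have pE := radial_decompose p0.
move: (enorm p) (radial p) t0 r1 r0 E pE => t r t0 r1 r0 E ->.
have tn0 : t != 0 by rewrite gt_eqF.
have -> : \sum_k eta (t *: r) a b (row k Q) * eta (t *: r) c d (row k Q) =
  t^-1 ^+ 6 * \sum_k eta r a b (row k Q) * eta r c d (row k Q).
  rewrite mulr_sumr; apply: eq_bigr => k _.
  rewrite (etaZ np a b _ t0 r0) (etaZ np c d _ t0 r0).
  by move: (eta r _ _ _) (eta r _ _ _) => ? ?; ring.
rewrite E (detaZ np a b c d t0 r0) !(dotZl, dotZr) r1 mulr1.
move: (deta r a b c d) (dot r a) (dot r b) (dot r c) (dot r d) (dot a c) (dot b d) (dot a d)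
  (dot b c) tau^-1 => *.
by field.
Qed.

(** The metric terms have zero derivative and the powers of [dot p p] act as the constant 1, so only
    second derivatives of [eta] remain on the right. They enter through the derivative of [d eta],
    which is what lets them be eliminated. *)
Lemma derive_eta_sum (Q : 'M[R]_8) x e a b c d : sphere7 x -> Q *m Q^T = 1%:M ->
  dot x e = 0 -> dot x a = 0 -> dot x b = 0 -> dot x c = 0 -> dot x d = 0 ->
  \sum_k (Deta x e a b (row k Q) * eta x c d (row k Q) +
          eta x a b (row k Q) * Deta x e c d (row k Q)) =
  tau^-1 * (DDeta x e a b c d - DDeta x e b a c d + DDeta x e c a b d - DDeta x e d a b c).
Proof.
move=> x1 QQ xe xa xb xc xd; have x0 := sphere_neq0 x1.
have HL : is_derive x e
    (fun p => dot p p ^+ 5 * (\sum_k eta p a b (row k Q) * eta p c d (row k Q)))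
    (\sum_k (Deta x e a b (row k Q) * eta x c d (row k Q) +
          eta x a b (row k Q) * Deta x e c d (row k Q))).
  apply: (is_derive_dotX_mul x1 xe); apply: is_derive_bigsum => k.
  exact: is_derive_mul (is_derive_eta np _ _ _ _ x0) (is_derive_eta np _ _ _ _ x0).
have Hd := is_derive_deta e a b c d x0.
have HG a' c' xa' xc' := is_derive_gram xe xa' xc' (a := a') (c := c').
have HR := is_derive_add (is_derive_sub (is_derive_mul (HG _ _ xa xc) (HG _ _ xb xd))
  (is_derive_mul (HG _ _ xa xd) (HG _ _ xb xc)))
  (is_derive_cmul tau^-1 (is_derive_dotX_mul x1 xe 4 Hd)).
have [_ <-] := HL.
rewrite (derive_near _ x0 (fun p hp => eta_sum_nonzero a b c d hp QQ)).
by have [_ ->] := HR; rewrite !(mul0r, mulr0, oppr0, add0r, addr0).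
Qed.

(* The conclusion says that the tangential part of the covariant derivative of
   [omega] is totally antisymmetric. *)
Lemma tangential_derivative x (Q : 'M[R]_8) (q : nat -> 'rV[R]_8) : sphere7 x ->
  Q *m Q^T = 1%:M ->
  (forall F : 'rV[R]_8 -> R, \sum_k F (row k Q) = F x + sum7 (fun l => F (q l))) ->
  (forall l, dot x (q l) = 0) ->
  (forall j k l, (0 < j < 8)%N -> (0 < k < 8)%N -> (0 < l < 8)%N ->
    eta x (q j) (q k) (q l) = (phi_coef j k l)%:~R) ->
  (forall j k l m, (0 < j < 8)%N -> (0 < k < 8)%N -> (0 < l < 8)%N -> (0 < m < 8)%N ->
    deta x (q j) (q k) (q l) (q m) = tau * (psi_coef j k l m)%:~R) ->
  forall j k l m, (0 < j < 8)%N -> (0 < k < 8)%N -> (0 < l < 8)%N -> (0 < m < 8)%N ->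
  Deta x (q j) (q k) (q l) (q m) = (psi_coef j k l m)%:~R * (tau / 4%:R).
Proof.
move=> x1 QQ Qsum xq etaq detaq; have x0 := sphere_neq0 x1.
have etax u v : eta x u v x = 0.
  have [-> _ _] := alternating3_linear (fun u v w => etaS12 np u v w x0)
    (fun u v w => etaS23 np u v w x0) (fun u u' v w => etaDl np u u' v w x0)
    (fun r u v w => etaZl np r u v w x0).
  by rewrite (eta_radial np _ _ x0) oppr0.
pose dd e u v w z := DDeta x e u v w z - DDeta x e v u w z + DDeta x e w u v z
  - DDeta x e z u v w.
have key j k l m r : (0 < j < 8)%N -> (0 < k < 8)%N -> (0 < l < 8)%N ->
    (0 < m < 8)%N -> (0 < r < 8)%N ->
    lin (phi_coef m r) (fun s => Deta x (q j) (q k) (q l) (q s)) +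
    lin (phi_coef k l) (fun s => Deta x (q j) (q m) (q r) (q s)) =
    tau^-1 * dd (q j) (q k) (q l) (q m) (q r).
  move=> j8 k8 l8 m8 r8.
  have E := derive_eta_sum x1 QQ (xq j) (xq k) (xq l) (xq m) (xq r).
  pose F s := Deta x (q j) (q k) (q l) s * eta x (q m) (q r) s +
    eta x (q k) (q l) s * Deta x (q j) (q m) (q r) s.
  (* The trace over R^8 has one term more than the trace over the tangent space, and [eta] kills the
     radial direction. *)
  have Fx : F x = 0.
    apply: etrans (addr0 0); congr (_ + _).
      exact: etrans (congr1 _ (etax (q m) (q r))) (mulr0 _).
    exact: etrans (congr1 (fun s => s * _) (etax (q k) (q l))) (mul0r _).
  have EF := etrans (esym (Qsum F)) E.
  rewrite Fx in EF. rewrite add0r in EF.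
  apply: etrans EF; rewrite /lin -sum7D; apply: eq_sum7 => s s8; rewrite /F.
  by rewrite (etaq m r s m8 r8 s8) (etaq k l s k8 l8 s8); congr (_ + _); rewrite mulrC.
apply: (@torsion_scalar R (fun j k l m => Deta x (q j) (q k) (q l) (q m)) tau).
- by move=> *; exact: (DetaS12 np _ _ _ _ x0).
- by move=> *; exact: (DetaS23 np _ _ _ _ x0).
(* With a repeated argument the alternated second derivative on the right vanishes. *)
- move=> j k l m j8 k8 l8 m8; rewrite addrC (key j k l m l j8 k8 l8 m8 l8).
  rewrite /dd (d_repeated (f := DDeta x (q j))) ?mulr0 // => *.
    exact: (DDetaS12 _ _ _ _ _ x0).
  exact: (DDetaS23 _ _ _ _ _ x0).
- by move=> j k l m j8 k8 l8 m8; rewrite -[RHS]mulrC -(detaq j k l m j8 k8 l8 m8).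
- move=> Q5.
  have K j k l m r (j8 : (0 < j < 8)%N) (k8 : (0 < k < 8)%N) (l8 : (0 < l < 8)%N)
      (m8 : (0 < m < 8)%N) (r8 : (0 < r < 8)%N) :
      Q5 j k l m r = tau^-1 * dd (q j) (q k) (q l) (q m) (q r).
    exact: key.
  move: Q5 K => Q5 K j k l m r j8 k8 l8 m8 r8.
  rewrite (K j k l m r j8 k8 l8 m8 r8) (K k j l m r k8 j8 l8 m8 r8).
  rewrite (K l j k m r l8 j8 k8 m8 r8) (K m j k l r m8 j8 k8 l8 r8).
  rewrite (K r j k l m r8 j8 k8 l8 m8) -mulrBr -mulrDr -mulrBr -mulrDr.
  (* The goal is now [tau^-1] times the alternated sum of second derivatives, that is, [d (d eta)]
     on five frame vectors. *)
  have S e u v w z := DDeta_schwarz np e u v w z x0.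
  exact: etrans (congr1 _ (d_squared S (q j) (q k) (q l) (q m) (q r))) (mulr0 _).
Qed.

End Torsion.

Section FrameExtension.
Variables (R : realType) (x : 'rV[R]_8) (Q : 'M[R]_8) (q : nat -> 'rV[R]_8).
Hypotheses (QQ : Q *m Q^T = 1%:M) (x1 : dot x x = 1).
Hypothesis Qsum : forall F : 'rV[R]_8 -> R,
  \sum_k F (row k Q) = F x + sum7 (fun l => F (q l)).
Hypothesis xq : forall l, dot x (q l) = 0.

Lemma linear_frame_eq0 (L : 'rV[R]_8 -> R) :
  (forall u v, L (u + v) = L u + L v) -> (forall c u, L (c *: u) = c * L u) ->
  L x = 0 -> (forall l, (0 < l < 8)%N -> L (q l) = 0) -> forall u, L u = 0.
Proof.
move=> LD LZ Lx Lq u; rewrite (orthonormal_linear QQ u LD LZ).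
rewrite (Qsum (fun v => dot u v * L v)) Lx mulr0 add0r.
by rewrite /sum7 !Lq // !mulr0 !addr0.
Qed.

(* [h] and [D] stand for the values at [x] of a form and of its derivative. *)
Lemma derivative_antisymmetric (D : 'rV[R]_8 -> 'rV[R]_8 -> 'rV[R]_8 -> 'rV[R]_8 -> R)
    (h : 'rV[R]_8 -> 'rV[R]_8 -> 'rV[R]_8 -> R) :
  (forall u u' v w z, D (u + u') v w z = D u v w z + D u' v w z) ->
  (forall c u v w z, D (c *: u) v w z = c * D u v w z) ->
  (forall u v v' w z, D u (v + v') w z = D u v w z + D u v' w z) ->
  (forall c u v w z, D u (c *: v) w z = c * D u v w z) ->
  (forall u v w z, D u w v z = - D u v w z) ->
  (forall u v w z, D u v z w = - D u v w z) ->
  (forall u v v' w, h (u + v) v' w = h u v' w + h v v' w) ->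
  (forall c u v w, h (c *: u) v w = c * h u v w) ->
  (forall u v w, h v u w = - h u v w) -> (forall u v w, h u w v = - h u v w) ->
  (forall v w, h x v w = 0) ->
  (forall u w z, D u x w z = - h u w z) ->
  (forall v w z, D x v w z = - (3%:R * h v w z)) ->
  (forall j k l m, (0 < j < 8)%N -> (0 < k < 8)%N -> (0 < l < 8)%N -> (0 < m < 8)%N ->
     D (q j) (q k) (q l) (q m) = - D (q k) (q j) (q l) (q m)) ->
  let G u v w z := D u v w z + 4%:R * (dot x u * h v w z) in
  forall u v w z, G u v w z = - G v u w z.
Proof.
move=> D0D D0Z D1D D1Z D12 D23 hD hZ h12 h23 hx Dx1 Dx0 Dq G u v w z.
apply/eqP; rewrite -addr_eq0; apply/eqP; move: u v w z.
pose L u v w z := G u v w z + G v u w z.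
have D2D a b c c' d : D a b (c + c') d = D a b c d + D a b c' d.
  by rewrite D12 D1D opprD -!D12.
have D2Z a b r c d : D a b (r *: c) d = r * D a b c d.
  by rewrite D12 D1Z -mulrN -D12.
have D3D a b c d d' : D a b c (d + d') = D a b c d + D a b c d'.
  by rewrite D23 D2D opprD -!D23.
have D3Z a b c r d : D a b c (r *: d) = r * D a b c d.
  by rewrite D23 D2Z -mulrN -D23.
have [_ h3D h3Z] := alternating3_linear h12 h23 (fun u u' v w => hD u u' v w) hZ.
have h2D a b b' c : h a (b + b') c = h a b c + h a b' c by rewrite h12 hD opprD -!h12.
have h2Z a r b c : h a (r *: b) c = r * h a b c by rewrite h12 hZ -mulrN -h12.
have LS u v w z : L u v w z = L v u w z by rewrite /L addrC.
have LD u u' v w z : L (u + u') v w z = L u v w z + L u' v w z.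
  by rewrite /L /G D0D D1D hD dotDr; ring.
have LZ c u v w z : L (c *: u) v w z = c * L u v w z.
  by rewrite /L /G D0Z D1Z hZ dotZr; ring.
(* The weight 4 is forced here: Euler's identity gives -3, the contraction -1, and the radial term
   of [G] compensates with +4. *)
have Lx v w z : L x v w z = 0.
  by rewrite /L /G Dx0 Dx1 x1 hx; ring.
have LqE j k w z : L (q j) (q k) w z = D (q j) (q k) w z + D (q k) (q j) w z.
  by rewrite /L /G !xq; ring.
have Lqx j k z : L (q j) (q k) x z = 0.
  by rewrite LqE (D12 _ x) Dx1 (D12 _ x) Dx1 (h12 (q j)); ring.
(* The last hypothesis covers frame vectors only. Linearity extends it one slot at a time, from the
   fourth to the first, the radial value being 0 each time. *)
have Lqqq j k l z : (0 < j < 8)%N -> (0 < k < 8)%N -> (0 < l < 8)%N ->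
    L (q j) (q k) (q l) z = 0.
  move=> j8 k8 l8; move: z; apply: linear_frame_eq0.
  - by move=> z z'; rewrite !LqE !D3D; ring.
  - by move=> c z; rewrite !LqE !D3Z; ring.
  - by move: (Lqx j k (q l)); rewrite !LqE (D23 _ _ x) (D23 _ _ x) => E;
      rewrite -opprD E oppr0.
  - by move=> m m8; rewrite LqE (Dq j k l m) // addNr.
have Lqq j k w z : (0 < j < 8)%N -> (0 < k < 8)%N -> L (q j) (q k) w z = 0.
  move=> j8 k8; move: w; apply: linear_frame_eq0.
  - by move=> w w'; rewrite !LqE !D2D; ring.
  - by move=> c w; rewrite !LqE !D2Z; ring.
  - exact: Lqx.
  - by move=> l l8; exact: Lqqq.
have Lq j v w z : (0 < j < 8)%N -> L (q j) v w z = 0.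
  move=> j8; rewrite LS; move: v; apply: linear_frame_eq0 => // k k8.
  exact: Lqq.
move=> u v w z; rewrite -/(L u v w z); move: u; apply: linear_frame_eq0 => // j j8.
exact: Lq.
Qed.

End FrameExtension.

(** The argument behind the uniqueness of the Levi-Civita connection: applying the two
    transpositions alternately, three times each, restores the order of the arguments but changes
    the sign three times. *)
Lemma braid (R : realType) (V : Type) (f : V -> V -> V -> R) :
  (forall e u v, f e u v = f u e v) -> (forall e u v, f e u v = - f e v u) ->
  forall e u v, f e u v = 0.
Proof.
move=> S A e u v.
have : f e u v = - f e u v by rewrite {1}A S A opprK S A S.
by move=> h; lra.
Qed.

Lemma segment_neq0 (R : realType) (x y : 'rV[R]_8) (t : R) :
  sphere7 x -> sphere7 y -> 0 <= dot x y -> 0 <= t <= 1 ->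
  x + t *: (y - x) != 0.
Proof.
move=> x1 y1 xy /andP[t0 t1]; apply/eqP => E.
have := congr1 (fun v => dot v v) E; rewrite dot0l.
rewrite !(dotDl, dotDr, dotZl, dotZr, dotNl, dotNr) (dotC y x) x1 y1.
move: (dot x y) xy => s s0 E2.
have h1 : 0 <= t * (1 - t) * s by rewrite !mulr_ge0 // subr_ge0.
(* Since [t^2 + (1 - t)^2 = (1 + (2 t - 1)^2) / 2], the squared length on the segment is at least
   1/2. *)
have h2 : 0 <= (2%:R * t - 1) * (2%:R * t - 1) by rewrite -expr2 sqr_ge0.
by lra.
Qed.

(* Two unit vectors are joined by two segments through a unit vector orthogonal
   to the first; neither contains the origin. *)
Lemma sphere_constant (R : realType) (f : 'rV[R]_8 -> R) x y b :
  (forall p e, p != 0 -> is_derive p e f 0) -> sphere7 x -> sphere7 y ->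
  sphere7 b -> dot x b = 0 -> f y = f x.
Proof.
move=> df x1 y1 b1 xb.
have seg a c : sphere7 a -> sphere7 c -> 0 <= dot a c -> f c = f a.
  by move=> a1 c1 ac; apply: constant_on_segment => // t; exact: segment_neq0.
have [m [m1 xm my]] : exists m, [/\ sphere7 m, 0 <= dot x m & 0 <= dot m y].
  case: (lerP 0 (dot b y)) => h; [exists b|exists (- b)].
    by split; [exact: b1|rewrite xb|].
  split; [by rewrite /sphere7 /= dotNl dotNr opprK b1|by rewrite dotNr xb oppr0|].
  by rewrite dotNl oppr_ge0 ltW.
by rewrite (seg m y m1 y1 my) (seg x m x1 m1 xm).
Qed.

(** * Constancy of the derivative *)

Section Constancy.
Variables (R : realType) (omega : diff_form R 3 8) (tau : R).
Hypothesis np : nearly_parallel omega tau.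
Implicit Types (a b c d e u v w x y z p : 'rV[R]_8) (t : R).
Local Notation eta := (cone_form omega).
Local Notation Deta := (cone_derive omega).
Local Notation deta := (cone_d omega).
Local Notation DDeta := (cone_derive2 omega).

(* The derivative at [y] of [|y|^4 eta (v, w, z)] in the direction [u]. *)
Definition linear_derive y u v w z : R :=
  dot y y ^+ 2 * Deta y u v w z + 4%:R * (dot y y * (dot y u * eta y v w z)).
Local Notation Dbeta := linear_derive.

(** The derivative of a field of degree 1 has degree 0. Antisymmetry on the sphere therefore spreads
    to all nonzero points, where it can be differentiated. *)
Lemma DbetaZ t y u v w z : 0 < t -> y != 0 -> Dbeta (t *: y) u v w z = Dbeta y u v w z.
Proof.
move=> t0 y0; rewrite /linear_derive (DetaZ np _ _ _ _ t0 y0) (etaZ np _ _ _ t0 y0)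
  !(dotZl, dotZr).
have tn0 : t != 0 by rewrite gt_eqF.
by move: (Deta _ _ _ _ _) (eta _ _ _ _) (dot y y) (dot y u) => *; field.
Qed.

Lemma Dbeta_sphere_antisymmetric x u v w z : sphere7 x ->
  Dbeta x u v w z = - Dbeta x v u w z.
Proof.
move=> x1; have x0 := sphere_neq0 x1; have [B [[fB _] etaB detaB]] := sphere_frame np x1.
have GE a b c d : Dbeta x a b c d = Deta x a b c d + 4%:R * (dot x a * eta x b c d).
  by rewrite /linear_derive x1 expr1n !mul1r.
rewrite !GE.
pose q l := row (inord l.-1) B.
have coq l m : (0 < l < 8)%N -> (0 < m < 8)%N -> frame_coord B (q l) m = basis_vec R l m.
  by move=> l8 m8; exact: (adapted_basis l8 fB m8).
have QQ := adapted_orthonormal x1 fB.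
have Qsum := adapted_sum x B.
have xq l : dot x (q l) = 0 by case: fB => Btan _; exact: Btan.
apply: (@derivative_antisymmetric R x (adapted x B) q QQ x1 Qsum xq (Deta x) (eta x)).
- exact: (fun u u' v w z => DetaD0 np u u' v w z x0).
- exact: (fun r u v w z => DetaZ0 np r u v w z x0).
- exact: (fun u v v' w z => DetaDl np u v v' w z x0).
- exact: (fun r u v w z => DetaZl np r u v w z x0).
- exact: (fun u v w z => DetaS12 np u v w z x0).
- exact: (fun u v w z => DetaS23 np u v w z x0).
- exact: (fun u u' v w => etaDl np u u' v w x0).
- exact: (fun r u v w => etaZl np r u v w x0).
- exact: (fun u v w => etaS12 np u v w x0).
- exact: (fun u v w => etaS23 np u v w x0).
- exact: (fun v w => eta_radial np v w x0).
- exact: (fun u w z => Deta_contract np u w z x0).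
- exact: (fun v w z => Deta_euler np v w z x0).
have H := @tangential_derivative R omega tau np x (adapted x B) q x1 QQ Qsum xq.
have H1 j k l : (0 < j < 8)%N -> (0 < k < 8)%N -> (0 < l < 8)%N ->
    eta x (q j) (q k) (q l) = (phi_coef j k l)%:~R.
  by move=> j8 k8 l8; rewrite etaB -phi_of_basis; apply: eq_phi_of => m m8; exact: coq.
have H2 j k l m : (0 < j < 8)%N -> (0 < k < 8)%N -> (0 < l < 8)%N -> (0 < m < 8)%N ->
    deta x (q j) (q k) (q l) (q m) = tau * (psi_coef j k l m)%:~R.
  move=> j8 k8 l8 m8; rewrite detaB -psi_of_basis; congr (_ * _).
  by apply: eq_psi_of => r r8; exact: coq.
move=> j k l m j8 k8 l8 m8.
rewrite (H H1 H2 j k l m j8 k8 l8 m8) (H H1 H2 k j l m k8 j8 l8 m8).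
by rewrite -!psi_of_basis psi_of_swap12 mulNr.
Qed.

Lemma Dbeta_antisymmetric y u v w z : y != 0 -> Dbeta y u v w z = - Dbeta y v u w z.
Proof.
move=> y0; have t0 := enorm_gt0 y0; have r1 := sphere_radial y0.
have r0 := sphere_neq0 r1; have := Dbeta_sphere_antisymmetric u v w z r1.
have yE := radial_decompose y0.
have h a b : Dbeta y a b w z = Dbeta (radial y) a b w z.
  by rewrite {1}yE (DbetaZ _ _ _ _ t0 r0).
by rewrite !h.
Qed.

Lemma is_derive_Dbeta y e u v w z : y != 0 ->
  is_derive y e (fun p => Dbeta p u v w z) 0.
Proof.
move=> y0.
pose N := dot y y.
(* The derivative of [Dbeta _ b c w z] in the direction [a], written out so that its symmetry in [a]
   and [b] reduces to that of [DDeta]. *)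
pose V a b c : R :=
  (2%:R * dot y a * N + N * (2%:R * dot y a)) * Deta y b c w z + N * N * DDeta y a b c w z
  + 4%:R * (2%:R * dot y a * (dot y b * eta y c w z) +
     N * (dot a b * eta y c w z + dot y b * Deta y a c w z)).
have HV a b c : is_derive y a (fun p => Dbeta p b c w z) (V a b c).
  have H1 := is_derive_mul (is_derive_dot y a) (is_derive_dot y a).
  have H2 := is_derive_mul H1 (is_derive_Deta np a b c w z y0).
  have H3 := is_derive_mul (is_derive_dotr y a b) (is_derive_eta np a c w z y0).
  have H4 := is_derive_mul (is_derive_dot y a) H3.
  have H := is_derive_add H2 (is_derive_cmul 4%:R H4).
  by apply: is_derive_ext H => p; rewrite /linear_derive expr2.
have VS a b c : V a b c = V b a c.
  rewrite /V (DDeta_schwarz np a b c w z y0) (dotC b a).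
  move: (DDeta y b a c w z) (Deta y b c w z) (Deta y a c w z) (eta y c w z) => *.
  by ring.
have VA a b c : V a b c = - V a c b.
  have [_ E1] := HV a b c; have [_ E2] := is_derive_cmul (-1) (HV a c b).
  rewrite -E1 -mulN1r -E2; apply: (derive_near a y0) => p hp.
  by rewrite mulN1r; exact: Dbeta_antisymmetric.
by rewrite -(braid VS VA e u v); exact: HV.
Qed.

Lemma Dbeta_constant x y u v w z : sphere7 x -> sphere7 y ->
  Dbeta y u v w z = Dbeta x u v w z.
Proof.
move=> x1 y1; have [B [[[Btan Bort] _] _ _]] := sphere_frame np x1.
apply: (sphere_constant (f := fun p => Dbeta p u v w z) (b := row 0 B)).
- exact: (fun p e hp => is_derive_Dbeta e u v w z hp).
- exact: x1.
- exact: y1.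
- by rewrite /sphere7 /= Bort.
- exact: (Btan 0).
Qed.

(** By total antisymmetry the four terms of the exterior derivative of [|y|^4 eta] are equal;
    Leibniz's rule at |x| = 1 gives the right-hand side, where the sum in parentheses is
    [x /\ eta]. *)
Lemma Dbeta_form x u v w z : sphere7 x ->
  4%:R * Dbeta x u v w z = deta x u v w z +
  4%:R * (dot x u * eta x v w z - dot x v * eta x u w z + dot x w * eta x u v z
          - dot x z * eta x u v w).
Proof.
move=> x1; have x0 := sphere_neq0 x1.
have A a b c d : Dbeta x a b c d = - Dbeta x b a c d by exact: Dbeta_antisymmetric.
have GE a b c d : Dbeta x a b c d = Deta x a b c d + 4%:R * (dot x a * eta x b c d).
  by rewrite /linear_derive x1 expr1n !mul1r.
have A1 := A v u w z; have A2 := A w u v z; have A3 := A z u v w.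
have S1 : Dbeta x u w v z = - Dbeta x u v w z.
  by rewrite !GE (DetaS12 np _ _ _ _ x0) (etaS12 np _ _ _ x0); ring.
have S2 : Dbeta x u z v w = Dbeta x u v w z.
  rewrite !GE (DetaS12 np u v z w x0) (DetaS23 np u v w z x0) (etaS12 np v z w x0).
  by rewrite (etaS23 np v w z x0); ring.
move: A1 A2 A3 S1 S2; rewrite !GE /cone_d.
move: (eta x v w z) (eta x u w z) (eta x u v z) (eta x u v w) (eta x w v z) (eta x z v w).
move: (dot x u) (dot x v) (dot x w) (dot x z).
move: (Deta x u v w z) (Deta x v u w z) (Deta x w u v z) (Deta x z u v w)
  (Deta x u w v z) (Deta x u z v w) => *.
lra.
Qed.

End Constancy.

(** * Comparison with the standard form *)

Lemma psi_of_scale (R : comPzRingType) (c : R) (u v w z : nat -> R) :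
  psi_of (fun l => c * u l) (fun l => c * v l) (fun l => c * w l) (fun l => c * z l) =
  c ^+ 4 * psi_of u v w z.
Proof. by rewrite /psi_of /det4 /det3; ring. Qed.

Lemma rowZ (R : pzRingType) m n (c : R) (B : 'M[R]_(m, n)) i :
  row i (c *: B) = c *: row i B.
Proof. by apply/rowP => j; rewrite !mxE. Qed.

Section StandardForm.
Variables (R : realType) (x : 'rV[R]_8) (B : 'M[R]_(7, 8)).
Implicit Types u v w z : 'rV[R]_8.

(** The rows of [M] are the images of the [u_i] under the matrix [adapted x B], so this is the
    pullback of [Phi0], put in the shape of [Dbeta_form]. *)
Lemma Phi0_adapted (M : 'M[R]_(4, 8)) u0 u1 u2 u3 :
  (forall i j, M i j = dot (nth 0 [:: u0; u1; u2; u3] i) (row j (adapted x B))) ->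
  Phi0 M =
  dot u0 x * phi_of (frame_coord B u1) (frame_coord B u2) (frame_coord B u3)
    - dot u1 x * phi_of (frame_coord B u0) (frame_coord B u2) (frame_coord B u3)
  + dot u2 x * phi_of (frame_coord B u0) (frame_coord B u1) (frame_coord B u3)
    - dot u3 x * phi_of (frame_coord B u0) (frame_coord B u1) (frame_coord B u2)
  + psi_of (frame_coord B u0) (frame_coord B u1) (frame_coord B u2) (frame_coord B u3).
Proof.
move=> ME.
have M0 i : (M : 'M[R]_(4, 1 + 7)) i 0 = dot (nth 0 [:: u0; u1; u2; u3] i) x.
  rewrite ME /adapted (_ : 0 = lshift 7 (0 : 'I_1)); last exact: val_inj.
  by rewrite (@rowKu _ 1 7) row_id.
have Ml i l : (M : 'M[R]_(4, 1 + 7)) i (rshift 1 (inord l.-1)) =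
    frame_coord B (nth 0 [:: u0; u1; u2; u3] i) l.
  by rewrite ME /adapted (@rowKd _ 1 7).
rewrite /Phi0 star_phi0E !big_ord_recl big_ord0 !M0 !phi0E /= /bump /= addr0.
have S : psi_of (entry (rsubmx (M : 'M[R]_(4, 1 + 7))) 0)
  (entry (rsubmx (M : 'M[R]_(4, 1 + 7))) 1) (entry (rsubmx (M : 'M[R]_(4, 1 + 7))) 2)
    (entry (rsubmx (M : 'M[R]_(4, 1 + 7))) 3) =
      psi_of (frame_coord B u0) (frame_coord B u1) (frame_coord B u2) (frame_coord B u3).
  by apply: eq_psi_of => l l8; rewrite /entry mxE Ml inordK.
rewrite S {S}.
have P (i : 'I_4) : phi_of (entry (rsubmx (row' i (M : 'M[R]_(4, 1 + 7)))) 0)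
   (entry (rsubmx (row' i (M : 'M[R]_(4, 1 + 7)))) 1)
     (entry (rsubmx (row' i (M : 'M[R]_(4, 1 + 7)))) 2) =
   let c k := frame_coord B (nth 0 [:: u0; u1; u2; u3] (bump i k)) in phi_of (c 0%N) (c 1%N)
     (c 2%N).
  by apply: eq_phi_of => l l8; rewrite /entry !mxE Ml /= inordK.
rewrite !P /= /bump /=.
move: (dot u0 x) (dot u1 x) (dot u2 x) (dot u3 x) (psi_of _ _ _ _) (phi_of _ _ _)
  (phi_of _ _ _) (phi_of _ _ _) (phi_of _ _ _) => *.
by ring.
Qed.

Lemma derive_act (h : 'M[R]_8) y v : 'D_v (act h) y = act h v.
Proof.
have H i j : is_derive y v (fun p => act h p i j) (act h v i j).
  have e p : dot p (row j h) = act h p i j by rewrite /act dot_rowE mxE.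
  have H := is_derive_dotr y v (row j h); rewrite e in H.
  exact: is_derive_ext e H.
rewrite derive_mx; last by apply/derivable_mxP => i j; have [] := H i j.
by apply/matrixP => i j; rewrite mxE; have [_ ->] := H i j.
Qed.

End StandardForm.

Section Main.
Variables (R : realType) (omega : diff_form R 3 8) (tau : R).
Hypothesis np : nearly_parallel omega tau.
Implicit Types (a b c d e u v w x y z p : 'rV[R]_8) (t : R).
Local Notation eta := (cone_form omega).
Local Notation Deta := (cone_derive omega).
Local Notation deta := (cone_d omega).
Local Notation Dbeta := (linear_derive omega).

(** Euler's relation in degree 1 recovers the field from its derivative at [y], and that derivative
    is the same at [x]. *)
Lemma eta_Dbeta x y v w z : sphere7 x -> sphere7 y -> eta y v w z = Dbeta x y v w z.
Proof.
move=> x1 y1; rewrite -(Dbeta_constant np y v w z x1 y1).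
have y0 := sphere_neq0 y1.
rewrite {1}/linear_derive (Deta_euler np v w z y0) y1 expr1n.
by move: (eta y v w z) => r; ring.
Qed.

(** At the point [q 1] the vectors [q 2] and [q 4] are tangent and orthonormal, so by the
    contraction identity [omega] contracts with them to a unit covector. Computed from the constant
    4-form at [x0], this covector is [- tau / 4] times the seventh one: 124 is not a term of [phi],
    and 1247 is the only term of [psi] that contains it. *)
Lemma tau_square : (tau / 4%:R) ^+ 2 = 1.
Proof.
pose x0 : 'rV[R]_8 := delta_mx 0 0.
have x1 : sphere7 x0.
  rewrite /sphere7 /= /dot (bigD1 ord0) //= !mxE !eqxx mulr1 big1 ?addr0 // => i i0.
  by rewrite mxE (negbTE i0) andbF mul0r.
have [B [[fB _] etaB detaB]] := sphere_frame np x1.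
pose q l := row (inord l.-1) B.
have coq l m : (0 < l < 8)%N -> (0 < m < 8)%N -> frame_coord B (q l) m = basis_vec R l m.
  by move=> l8 m8; exact: (adapted_basis l8 fB m8).
have QQ := adapted_orthonormal x1 fB.
have [Btan Bort] := fB.
have xq l : dot x0 (q l) = 0 := Btan _.
have qq j k : (0 < j < 8)%N -> (0 < k < 8)%N -> dot (q j) (q k) = (j == k)%:R.
  move=> j8 k8; rewrite Bort -val_eqE /= !inordK; try lia.
  by congr ((_ : bool)%:R); apply/eqP/eqP; lia.
have q1 : sphere7 (q 1%N) by rewrite /sphere7 /= qq.
have etaq s : eta (q 1%N) (q 2%N) (q 4%N) s =
    tau / 4%:R * psi_of (basis_vec R 1) (basis_vec R 2) (basis_vec R 4) (frame_coord B s).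
  rewrite (eta_Dbeta _ _ _ x1 q1).
  have := Dbeta_form np (q 1%N) (q 2%N) (q 4%N) s x1.
  have E124 : eta x0 (q 1%N) (q 2%N) (q 4%N) = 0.
    rewrite etaB; transitivity (phi_of (basis_vec R 1) (basis_vec R 2) (basis_vec R 4)).
      by apply: eq_phi_of => m m8; exact: coq.
    by rewrite phi_of_basis (_ : phi_coef 1 2 4 = 0).
  rewrite !xq detaB E124.
  rewrite (_ : psi_of (frame_coord B (q 1%N)) _ _ _ =
    psi_of (basis_vec R 1) (basis_vec R 2) (basis_vec R 4) (frame_coord B s)); last first.
    by apply: eq_psi_of => m m8 //; exact: coq.
  move: (linear_derive _ _ _ _ _ _) (psi_of _ _ _ _) (eta _ _ _ _) (eta _ _ _ _)
    (eta _ _ _ _) (dot x0 s) => D P *.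
  lra.
have d0 : deta (q 1%N) (q 2%N) (q 4%N) (q 2%N) (q 4%N) = 0.
  have y0 := sphere_neq0 q1.
  move: (detaS23 np (q 2%N) (q 2%N) (q 4%N) (q 4%N) y0)
    (detaS12 np (q 2%N) (q 2%N) (q 4%N) (q 4%N) y0).
  move: (deta _ _ _ _ _) (deta _ _ _ _ _) => *; lra.
have := eta_sum np (q 2%N) (q 4%N) (q 2%N) (q 4%N) q1 QQ.
rewrite d0 !qq //=.
rewrite (adapted_sum x0 B (fun s =>
  eta (q 1%N) (q 2%N) (q 4%N) s * eta (q 1%N) (q 2%N) (q 4%N) s)).
rewrite !etaq.
have -> : psi_of (basis_vec R 1) (basis_vec R 2) (basis_vec R 4) (frame_coord B x0) = 0.
  have -> : frame_coord B x0 = (fun=> 0) by apply/funext => l; exact: Btan.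
  by rewrite /psi_of /det4 /det3; ring.
have S l : (0 < l < 8)%N ->
    psi_of (basis_vec R 1) (basis_vec R 2) (basis_vec R 4)
      (frame_coord B (row (inord l.-1) B)) = (psi_coef 1 2 4 l)%:~R.
  by move=> l8; rewrite -psi_of_basis; apply: eq_psi_of => // m m8; exact: coq.
rewrite /sum7 !etaq !S //.
have -> : psi_coef 1 2 4 7 = -1 by [].
do !rewrite [X in X%:~R](_ : psi_coef 1 2 4 _ = 0) //.
move: (tau / 4%:R) tau^-1 => s r E.
rewrite expr2; transitivity ((1 - 0 * 0) * (1 - 0 * 0) - (0 - 0 * 0) * (0 - 0 * 0)
  + r * 0 : R).
  by rewrite -E; ring.
by ring.
Qed.

(* If [tau < 0], the tangential block of [h] is reversed: this changes the sign
   of [phi0] but not that of [star_phi0]. *)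
Lemma conjugating_matrix : exists x0 B0, let h := adapted x0 ((tau / 4%:R) *: B0) in
  [/\ sphere7 x0, g2_frame omega x0 B0, in_O8 h &
    eq_on_sphere (pullback (act h) (@omega_std R)) (fun x A => tau / 4%:R * omega x A)].
Proof.
pose x0 : 'rV[R]_8 := delta_mx 0 0.
have x1 : sphere7 x0.
  rewrite /sphere7 /= /dot (bigD1 ord0) //= !mxE !eqxx mulr1 big1 ?addr0 // => i i0.
  by rewrite mxE (negbTE i0) andbF mul0r.
have [B [fB etaB detaB]] := sphere_frame np x1.
have eps2 := tau_square; set eps := tau / 4%:R in eps2 *.
have tauE : tau = 4%:R * eps by rewrite /eps; field.
exists x0, B => h; have [[Btan Bort] _] := fB.
have fh : orthonormal_frame x0 (eps *: B).
  split=> [i|i j]; rewrite !rowZ ?dotZr ?dotZl.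
    by rewrite (Btan i) mulr0.
  by rewrite Bort mulrA -expr2 eps2 mul1r.
have hh := adapted_orthonormal x1 fh.
split=> // x A sx tA; have [B' [[_ fB'] etaB' _]] := sphere_frame np sx.
have omegaE : omega x A = eta x (row (inord 0) A) (row (inord 1) A) (row (inord 2) A).
  by rewrite fB' // phi0E etaB'; apply: eq_phi_of => l l8; rewrite /entry mxE.
rewrite omegaE (eta_Dbeta _ _ _ x1 sx).
rewrite /pullback /omega_std (@Phi0_adapted R x0 (eps *: B) _ x (row (inord 0) A)
  (row (inord 1) A) (row (inord 2) A)); last first.
  have actE u j : act h u 0 j = dot u (row j h) by rewrite /act dot_rowE mxE.
  move=> i j; rewrite [LHS]mxE; case: (splitP (i : 'I_(1 + 3))) => k ->.
    by rewrite (ord1 k) actE.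
  rewrite mxE derive_act actE; case: k => [[|[|[|?]]]] //= k3;
    by congr (dot (row _ A) _); apply: val_inj; rewrite /= inordK.
have coE u : frame_coord (eps *: B) u = (fun l => eps * frame_coord B u l).
  by apply/funext => l; rewrite /frame_coord rowZ dotZr.
rewrite !coE !phi_of_scale psi_of_scale -/eps.
have := Dbeta_form np x (row (inord 0) A) (row (inord 1) A) (row (inord 2) A) x1.
rewrite detaB !etaB !(dotC x0).
have eps3 : eps ^+ 3 = eps by rewrite exprS eps2 mulr1.
have eps4 : eps ^+ 4 = 1 by rewrite exprS eps3 -expr2.
rewrite eps3 eps4 {1}tauE.
move: (linear_derive _ _ _ _ _ _) (psi_of _ _ _ _) (phi_of _ _ _) (phi_of _ _ _)
  (phi_of _ _ _) (phi_of _ _ _)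
  (dot x x0) (dot (row (inord 0) A) x0) (dot (row (inord 1) A) x0)
  (dot (row (inord 2) A) x0) => D P p1 p2 p3 p4 d1 d2 d3 d4 E.
have -> : D = eps * P + (d1 * p4 - d2 * p3 + d3 * p2 - d4 * p1) by lra.
(* The pullback of [Phi0] is [psi + eps (x0 /\ phi)] and the constant 4-form is
   [eps psi + x0 /\ phi]; as [eps^2 = 1], they differ by the factor [eps]. *)
have epsE X : eps * (eps * P + X) = P + eps * X.
  by rewrite mulrDr mulrA -expr2 eps2 mul1r.
by rewrite epsE; ring.
Qed.

End Main.

Theorem theorem0p2 (R : realType) (omega : diff_form R 3 8) (tau0 : R) :
  nearly_parallel omega tau0 ->
  (0 < tau0 -> std_oriented omega ->
     exists2 h : 'M[R]_8, in_SO8 h &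
       eq_on_sphere (pullback (act h) (@omega_std R)) omega) /\
  (exists2 h : 'M[R]_8, in_O8 h &
     eq_on_sphere (pullback (act h) (@omega_std R))
                  (fun x A => Num.sg tau0 * omega x A)).
Proof.
move=> np; have [x0 [B0 [x1 fB hh hE]]] := conjugating_matrix np.
have eps2 := tau_square np.
(* A number of square 1 is its own sign. *)
have sgE : Num.sg tau0 = tau0 / 4%:R.
  have /eqP := eps2; rewrite -[X in _ == X](expr1n _ 2) eqf_sqr => /orP[] /eqP E.
    by rewrite (_ : tau0 = 4%:R) ?gtr0_sg ?divff //; lra.
  by rewrite (_ : tau0 = - 4%:R) ?ltr0_sg ?mulNr ?divff ?oppr_lt0 //; lra.
split; last by exists (adapted x0 ((tau0 / 4%:R) *: B0)) => //; rewrite sgE.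
move=> t0 oo; have e1 : tau0 / 4%:R = 1 by rewrite -sgE gtr0_sg.
move: hh hE; rewrite e1 scale1r => hh hE; exists (adapted x0 B0); last first.
  by move=> x A sx tA; rewrite hE // mul1r.
(* For [tau0 = 4] the conjugating matrix is [x0] on top of [B0], whose determinant is the one that
   [std_oriented] makes positive; orthogonality leaves only 1. *)
split=> //; have := oo x0 B0 x1 fB; rewrite -/(adapted x0 B0) => d0.
have : \det (adapted x0 B0) ^+ 2 = 1.
  by rewrite expr2 -{2}det_tr -det_mulmx hh det1.
by move=> d2; nra.
Qed.
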